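(* Consider the Gaussian PIMAC with received signals $Y_1=X_1+X_2+h_{31}X_3+Z_1$ and $Y_2=h_{12}X_1+h_{22}X_2+X_3+Z_2$, real channel coefficients $h_{12},h_{22},h_{31}$, and power constraints $P_1,P_2,P_3$. If $h_{31}^2\leq 1$, then its sum-capacity satisfies $$C_\Sigma\leq \frac{1}{2}\log\left(1+\frac{P_1+P_2}{1+h_{31}^2P_3}\right)+\frac{1}{2}\log(1+P_3).$$
   Context: In the PIMAC, $Z_1,Z_2$ are i.i.d. (over time) additive white Gaussian noises with $Z_j\sim\mathcal{N}(0,1)$. Transmitter $i\in\{1,2,3\}$ encodes a message $m_i$, chosen uniformly and independently from $\{1,\dots,2^{nR_i}\}$, into a codeword $X_i^n\in\mathbb{R}^n$ with $\frac{1}{n}\sum_{j=1}^n\mathbb{E}[X_{i,j}^2]\leq P_i$. Receiver 1 decodes $(\hat m_1,\hat m_2)$ from $Y_1^n$ and receiver 2 decodes $\hat m_3$ from $Y_2^n$. A rate triple $(R_1,R_2,R_3)$ is achievable if there is a sequence of such codes with average probability that some $\hat m_i\neq m_i$ tending to $0$ as $n\to\infty$; the capacity region $\mathcal{C}$ is the set of achievable triples and the sum-capacity is $C_\Sigma=\max_{(R_1,R_2,R_3)\in\mathcal{C}}(R_1+R_2+R_3)$. Logarithms are base 2. *)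

(* Defs.v *)
From HB Require Import structures.
From mathcomp Require Import all_boot all_order all_algebra.
From mathcomp Require Import all_classical all_reals all_analysis.
Set Implicit Arguments. Unset Strict Implicit. Unset Printing Implicit Defensive.
Import Order.TTheory GRing.Theory Num.Theory.
Import numFieldNormedType.Exports.
Local Open Scope classical_set_scope.
Local Open Scope ring_scope.

Definition log2 {R : realType} (x : R) : R := ln x / ln 2.

(* number of messages 2^{nR}, rounded up to an integer (always >= 1) *)
Definition nmsg {R : realType} (n : nat) (Rt : R) : nat :=
  `|Num.ceil (2 `^ (n%:R * Rt))|%N.

Definition mutually_independent {d} {T : measurableType d} {R : realType}
  (P : probability T R) {I : eqType} (X : I -> T -> R) : Prop :=
  forall (s : seq I), uniq s ->
  forall B : I -> set R, (forall i, measurable (B i)) ->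
    P (\bigcap_(i in [set` s]) (X i @^-1` B i)) =
    (\prod_(i <- s) P (X i @^-1` B i))%E.

(* The noise processes: W (false) j = Z_{1,j}, W (true) j = Z_{2,j}, all
   measurable, standard normal N(0,1), and mutually independent. *)
Definition iid_std_gaussian_noise {d} {T : measurableType d} {R : realType}
  (P : probability T R) (W : bool -> nat -> T -> R) : Prop :=
  (forall b j, measurable_fun setT (W b j)) /\
  (forall b j (B : set R), measurable B -> P (W b j @^-1` B) = normal_prob 0 1 B) /\
  mutually_independent P (fun bj : bool * nat => W bj.1 bj.2).

Record pimac_code {R : realType} (n M1 M2 M3 : nat) := PimacCode {
  enc1 : 'I_M1 -> 'I_n -> R;
  enc2 : 'I_M2 -> 'I_n -> R;
  enc3 : 'I_M3 -> 'I_n -> R;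
  dec1 : n.-tuple R -> 'I_M1 * 'I_M2;
  dec2 : n.-tuple R -> 'I_M3 }.

(* power constraint (1/n) sum_j E[X_{i,j}^2] <= P_i with uniform messages,
   written multiplied out by n *)
Definition power_ok {R : realType} (n M : nat) (f : 'I_M -> 'I_n -> R) (Pw : R) :=
  (\sum_(m < M) \sum_(j < n) f m j ^+ 2) / M%:R <= n%:R * Pw.

Definition decoders_measurable {R : realType} n M1 M2 M3
  (c : @pimac_code R n M1 M2 M3) :=
  (forall m, measurable (dec1 c @^-1` [set m])) /\
  (forall m, measurable (dec2 c @^-1` [set m])).

Definition error_event {d} {T : measurableType d} {R : realType}
  (W : bool -> nat -> T -> R) (h12 h22 h31 : R) n M1 M2 M3
  (c : @pimac_code R n M1 M2 M3) (m1 : 'I_M1) (m2 : 'I_M2) (m3 : 'I_M3) : set T :=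
  [set w | let Y1 := [tuple enc1 c m1 j + enc2 c m2 j + h31 * enc3 c m3 j
                            + W false j w | j < n] in
           let Y2 := [tuple h12 * enc1 c m1 j + h22 * enc2 c m2 j + enc3 c m3 j
                            + W true j w | j < n] in
           dec1 c Y1 <> (m1, m2) \/ dec2 c Y2 <> m3].

Definition avg_error {d} {T : measurableType d} {R : realType}
  (P : probability T R) (W : bool -> nat -> T -> R) (h12 h22 h31 : R)
  n M1 M2 M3 (c : @pimac_code R n M1 M2 M3) : \bar R :=
  ((\sum_(m1 < M1) \sum_(m2 < M2) \sum_(m3 < M3)
      P (error_event W h12 h22 h31 c m1 m2 m3)) *
   ((M1 * M2 * M3)%:R^-1)%:E)%E.

Definition pimac_achievable {d} {T : measurableType d} {R : realType}
  (P : probability T R) (W : bool -> nat -> T -> R) (h12 h22 h31 P1 P2 P3 : R)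
  (R1 R2 R3 : R) : Prop :=
  exists c : forall n : nat,
      @pimac_code R n (nmsg n R1) (nmsg n R2) (nmsg n R3),
    (forall n, power_ok (enc1 (c n)) P1 /\ power_ok (enc2 (c n)) P2 /\
               power_ok (enc3 (c n)) P3) /\
    (forall n, decoders_measurable (c n)) /\
    (fun n => avg_error P W h12 h22 h31 (c n)) @ \oo --> 0%E.

(* Main.v *)
(* Write Y_1 = X_1 + X_2 + h (X_3 + Z_2) + c Z' with c^2 = 1 - h^2 and Z' a fresh
   Gaussian: each receiver sees its original law, so error probabilities are
   unaffected, and Y_1 is degraded with respect to X_3 + Z_2 given (X_1, X_2).
   Compare the law of (Y_1, X_3 + Z_2) with the reference law in which Y_1 is
   N(0, s1), s1 = 1 + P1 + P2 + h^2 P3, and X_3 + Z_2 has, given Y_1 and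
   (X_1, X_2), the posterior it would have if X_3 were Gaussian of power P3.
   Under the reference law Y_1 carries no information on (m_1, m_2), nor Y_2 on
   m_3 given the rest, so the success probabilities of all message triples sum
   to at most 1. Integrating e^t >= 1 + t at t = ln (number of triples) minus
   the log-likelihood ratio bounds the number of triples by the mean
   log-likelihood ratio. This ratio is quadratic, so only second moments of the
   (centred) codewords enter; its mean grows with the power used by X_3
   because h^2 <= 1. *)
Require Import Defs.
From HB Require Import structures.
From mathcomp Require Import all_boot all_order all_algebra.
From mathcomp Require Import all_classical all_reals all_analysis.
From mathcomp Require Import measurable_realfun.
From mathcomp Require Import ring lra.
Import Order.TTheory GRing.Theory Num.Theory.
Import numFieldNormedType.Exports.
Local Open Scope classical_set_scope.
Local Open Scope ring_scope.
Set Implicit Arguments. Unset Strict Implicit. Unset Printing Implicit Defensive.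

(** * Products of probabilities on tuples *)

Section tuple_cons.
Context {d} {X : measurableType d}.

Definition tcons n (p : X * n.-tuple X) : n.+1.-tuple X :=
  [the n.+1.-tuple X of p.1 :: p.2].

Lemma measurable_tcons n : measurable_fun [set: X * n.-tuple X] (@tcons n).
Proof. exact: measurable_cons. Qed.

HB.instance Definition _ n :=
  isMeasurableFun.Build _ _ _ _ (@tcons n) (@measurable_tcons n).

End tuple_cons.

Section tuple_product.
Context {d} {X : measurableType d} {R : realType}.

Fixpoint tprod n : ('I_n -> probability X R) -> probability (n.-tuple X) R :=
  match n with
  | 0 => fun=> [the probability _ R of \d_([tuple] : 0.-tuple X)]
  | n'.+1 => fun mu => [the probability _ R of
      distribution (mu ord0 \x tprod (fun i => mu (lift ord0 i)))%E (@tcons d X n')]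
  end.

Lemma ge0_integral_tprodS n (mu : 'I_n.+1 -> probability X R)
    (f : n.+1.-tuple X -> \bar R) :
  measurable_fun setT f -> (forall t, 0 <= f t)%E ->
  (\int[tprod mu]_t f t =
   \int[mu ord0]_x \int[tprod (fun i => mu (lift ord0 i))]_t f (tcons (x, t)))%E.
Proof.
move=> mf f0; rewrite ge0_integral_distribution//=.
rewrite fubini_tonelli1//=; first exact: measurableT_comp.

Qed.
End tuple_product.

Section tuple_product_theory.
Local Open Scope ereal_scope.
Context {R : realType}.

Lemma measurable_tuple_map {d d'} {X : measurableType d} {Y : measurableType d'}
    n (phi : 'I_n -> X -> Y) :
  (forall j, measurable_fun setT (phi j)) ->
  measurable_fun setT (fun t : n.-tuple X => [tuple phi j (tnth t j) | j < n]).
Proof.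
move=> mphi; apply/measurable_fun_tnthP => i.
rewrite (_ : _ \o _ = phi i \o (fun t => tnth t i)); last first.
  by apply/funext => t /=; rewrite tnth_mktuple.
by apply: measurableT_comp => //; exact: measurable_tnth.
Qed.

Lemma measurable_prod_tnth {d} {X : measurableType d} n (w : 'I_n -> X -> R) :
  (forall j, measurable_fun setT (w j)) ->
  measurable_fun setT (fun t : n.-tuple X => (\prod_(j < n) w j (tnth t j))%R).
Proof.
move=> mw; apply: measurable_prod => j _.
by apply: (measurableT_comp (mw j)); exact: measurable_tnth.
Qed.

Lemma measurable_tprod_section {d} {X : measurableType d} n
    (nu : probability (n.-tuple X) R) (f : n.+1.-tuple X -> \bar R) :
  measurable_fun setT f -> (forall t, 0 <= f t) ->
  measurable_fun setT (fun x => \int[nu]_t f (tcons (x, t))).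
Proof.
move=> mf f0.
apply: (measurable_fun_fubini_tonelli_F (m2 := nu)
  (fun p : X * n.-tuple X => f (tcons p))) => //.
exact: measurableT_comp.
Qed.

Lemma ge0_integral_tprod_image {d d'} {X : measurableType d}
    {Y : measurableType d'} n
    (mu : 'I_n -> probability X R) (nu : 'I_n -> probability Y R)
    (phi : 'I_n -> X -> Y) (w : 'I_n -> X -> R) :
  (forall j, measurable_fun setT (phi j)) ->
  (forall j, measurable_fun setT (w j)) -> (forall j x, (0 <= w j x)%R) ->
  (forall j (f : Y -> \bar R), measurable_fun setT f -> (forall y, 0 <= f y) ->
     \int[mu j]_x (f (phi j x) * (w j x)%:E) = \int[nu j]_y f y) ->
  forall f : n.-tuple Y -> \bar R, measurable_fun setT f -> (forall t, 0 <= f t) ->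
  \int[tprod mu]_t (f [tuple phi j (tnth t j) | j < n]
                    * (\prod_(j < n) w j (tnth t j))%:E) = \int[tprod nu]_t f t.
Proof.
elim: n mu nu phi w => [|n IHn] mu nu phi w mphi mw w0 hyp f mf f0.
  rewrite /= !integral_dirac//.
    by rewrite !diracT !mul1e big_ord0 mule1; congr f; apply: val_inj; case: mktuple => -[].
  apply: emeasurable_funM.
    by apply: (measurableT_comp mf); exact: measurable_tuple_map.
  by apply/measurable_EFinP; exact: measurable_prod_tnth.
rewrite !ge0_integral_tprodS//; last 2 first.
- apply: emeasurable_funM.
    by apply: (measurableT_comp mf); exact: measurable_tuple_map.
  by apply/measurable_EFinP; exact: measurable_prod_tnth.
- by move=> t; rewrite mule_ge0 ?f0// lee_fin prodr_ge0.
rewrite -hyp; last 2 first.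
- exact: measurable_tprod_section.
- by move=> y; exact: integral_ge0.
apply: eq_integral => x _.
have mfx : measurable_fun setT
    (fun u : n.-tuple Y => f (tcons (phi ord0 x, u))).
  by apply: (measurableT_comp mf); apply: measurableT_comp => //; exact: pair1_measurable.
rewrite -(IHn (fun j => mu (lift ord0 j)) _ (fun j => phi (lift ord0 j))
  (fun j => w (lift ord0 j)))//; last first.
by move=> j g mg g0; exact: hyp.
rewrite -ge0_integralZr//; last 3 first.
- apply: emeasurable_funM.
    apply: (measurableT_comp mfx).
    exact: (measurable_tuple_map (fun j => mphi (lift ord0 j))).
  apply/measurable_EFinP.
  exact: (measurable_prod_tnth (fun j => mw (lift ord0 j))).
- by move=> t _; rewrite mule_ge0 ?f0// lee_fin prodr_ge0.
- by rewrite lee_fin.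
apply: eq_integral => t _.
rewrite big_ord_recl /tcons/= (tnth_nth x)/= mulrC EFinM muleA; congr (f _ * _ * _).
  apply: eq_from_tnth => i; rewrite tnth_mktuple.
  case: (unliftP ord0 i) => [j ->|->].
    by rewrite !tnthS/= tnth_mktuple.
  by [].
by congr (_%:E); apply: eq_bigr => i _; rewrite tnthS.
Qed.

Lemma ge0_integral_tprod_sum {d} {X : measurableType d} n
    (mu : 'I_n -> probability X R) (g : 'I_n -> X -> R) :
  (forall j, measurable_fun setT (g j)) -> (forall j x, (0 <= g j x)%R) ->
  \int[tprod mu]_t (\sum_(j < n) g j (tnth t j))%:E =
  \sum_(j < n) \int[mu j]_x (g j x)%:E.
Proof.
have ms m (h : 'I_m -> X -> R) : (forall j, measurable_fun setT (h j)) ->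
    measurable_fun setT (fun t : m.-tuple X => (\sum_(j < m) h j (tnth t j))%R).
  move=> mh; apply: measurable_sum => j.
  by apply: (measurableT_comp (mh j)); exact: measurable_tnth.
elim: n mu g => [|n IHn] mu g mg g0.
  rewrite big_ord0; under eq_integral do rewrite big_ord0.
  by rewrite integral0.
rewrite ge0_integral_tprodS//; last 2 first.
- by apply/measurable_EFinP; exact: ms.
- by move=> t; rewrite lee_fin sumr_ge0.
rewrite big_ord_recl -(IHn _ (fun j => g (lift ord0 j)))//.
rewrite -[X in _ = _ + X]mule1 -(probability_setT (mu ord0)).
rewrite -integral_cst//= -ge0_integralD//; last 3 first.
- by move=> x _; rewrite lee_fin.
- exact/measurable_EFinP.
- by move=> x _; apply: integral_ge0 => t _; rewrite lee_fin sumr_ge0.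
apply: eq_integral => x _.
rewrite -[(g ord0 x)%:E]mule1.
rewrite -(probability_setT (tprod (fun i => mu (lift ord0 i)))).
rewrite -integral_cst//= -ge0_integralD//; last 3 first.
- by move=> t _; rewrite lee_fin.
- by move=> t _; rewrite lee_fin sumr_ge0.
- by apply/measurable_EFinP; exact: (ms _ (fun j => g (lift ord0 j))).
apply: eq_integral => t _; rewrite -EFinD big_ord_recl; congr (_%:E + _%:E)%E.
  by apply: eq_bigr => i _; rewrite /tcons tnthS.
Qed.

End tuple_product_theory.

Section tuple_box.
Context {d} {X : measurableType d} {R : realType}.

Definition tbox n (B : 'I_n -> set X) : set (n.-tuple X) :=
  [set t | forall i, B i (tnth t i)].

Lemma tboxE n (B : 'I_n -> set X) :
  tbox B = \bigcap_(i in [set: 'I_n]) ((@tnth n X)^~ i @^-1` B i).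
Proof. by apply/seteqP; split => t /= Bt => [i _|i]; [exact: Bt|exact: (Bt i)]. Qed.

Lemma measurable_tbox n (B : 'I_n -> set X) :
  (forall i, measurable (B i)) -> measurable (tbox B).
Proof.
move=> mB; rewrite tboxE; apply: fin_bigcap_measurable => // i _.
by rewrite -[X in measurable X]setTI; exact: (measurable_tnth i).
Qed.

Lemma tprod_tbox n (mu : 'I_n -> probability X R) (B : 'I_n -> set X) :
  (forall i, measurable (B i)) ->
  (tprod mu (tbox B) = \prod_(i < n) mu i (B i))%E.
Proof.
elim: n mu B => [|n IHn] mu B mB.
  rewrite big_ord0 /= diracE mem_set// => -[]//.
rewrite big_ord_recl -(IHn (fun i => mu (lift ord0 i)))//.
rewrite -product_measure1E//; last exact: measurable_tbox.
rewrite /= /distribution /pushforward; congr (product_measure1 _ _ _).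
apply/seteqP; split => [[x t]/= Bt|[x t]/= [Bx Bt] i].
  by split => [|i]; [exact: (Bt ord0)|have := Bt (lift ord0 i); rewrite tnthS].
case: (unliftP ord0 i) => [j ->|->]; last exact: Bx.
by rewrite tnthS; exact: Bt.
Qed.

Lemma tprod_unique n (mu : 'I_n -> probability X R)
    (nu : {measure set (n.-tuple X) -> \bar R}) :
  (forall B, (forall i, measurable (B i)) ->
     nu (tbox B) = \prod_(i < n) mu i (B i))%E ->
  forall A, measurable A -> nu A = tprod mu A.
Proof.
move=> nuE; pose G : set (set (n.-tuple X)) := [set tbox B | B in [set B | forall i, measurable (B i)]].
have setTbox : tbox (fun=> setT) = [set: n.-tuple X].
  by apply/seteqP; split.
have GT : G setT by exists (fun=> setT).
apply: (measure_unique G (fun=> setT)).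
- apply/seteqP; split => [A|].
    apply: smallest_sub; first exact: smallest_sigma_algebra.
    rewrite -bigcup_seq/= => _ [i _ [B mB <-]].
    apply: sub_sigma_algebra; exists (fun j => if j == i then B else setT).
      by move=> j/=; case: ifP.
    rewrite setTI; apply/seteqP; split => t /= => [/(_ i)|Bt j]; first by rewrite eqxx.
    by case: eqP => // ->.
  apply: smallest_sub; first exact: sigma_algebra_measurable.
  by move=> _ [B mB <-]; exact: measurable_tbox.
- move=> _ _ [B mB <-] [C mC <-]; exists (fun i => B i `&` C i).
    by move=> i; exact: measurableI.
  apply/seteqP; split => t /=; first by move=> BC; split=> i; case: (BC i).
  by move=> [Bt Ct] i; split.
- by [].
- by rewrite bigcup_const.
- by move=> _ [B mB <-]; rewrite nuE//; exact/esym/tprod_tbox.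
- move=> _; have -> : nu setT = 1%E.
    by rewrite -setTbox nuE// big1// => i _; rewrite probability_setT.
  by rewrite ltry.
Qed.

End tuple_box.

(* Locked: otherwise unification compares it with other measures by unfolding. *)
Fact gaussian_key : unit. Proof. exact: tt. Qed.
Definition gaussian {R : realType} (v : R) : probability (measurableTypeR R) R :=
  locked_with gaussian_key
    [the probability (measurableTypeR R) R of normal_prob 0 (Num.sqrt v)].

Lemma gaussianE {R : realType} (v : R) A :
  gaussian v A = normal_prob 0 (Num.sqrt v) A.
Proof. by rewrite /gaussian unlock. Qed.

Section noise.
Context {d} {T : measurableType d} {R : realType}.
Variables (P : probability T R) (W : bool -> nat -> T -> R).
Hypothesis iidW : iid_std_gaussian_noise P W.

Lemma noise_law b n (A : set (n.-tuple (measurableTypeR R))) : measurable A ->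
  P ((fun w => [tuple W b j w | j < n]) @^-1` A) =
  tprod (fun=> gaussian 1) A.
Proof.
case: iidW => mW [WN indW] mA.
pose v : T -> n.-tuple (measurableTypeR R) :=
  fun w => [tuple W b j w | j < n].
have mV : measurable_fun setT v.
  apply/measurable_fun_tnthP => i; rewrite (_ : _ \o _ = W b i); first exact: mW.
  by apply/funext => w /=; rewrite tnth_mktuple.
pose V : {mfun T >-> n.-tuple (measurableTypeR R)} := mfun_Sub (mem_set mV).
rewrite -[LHS]/(distribution P V A).
apply: tprod_unique => //.
move=> B mB.
pose B' (bj : bool * nat) := oapp B setT (insub bj.2).
have := indW [seq (b, val i) | i <- enum 'I_n] _ B'.
rewrite map_inj_uniq ?enum_uniq; last by move=> i j [/val_inj].
move=> /(_ isT) indB.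
set C := \bigcap_(i in _) _ in indB.
transitivity (P C); last first.
  rewrite indB; last by move=> [b' j]; rewrite /B'/=; case: insubP => [u _ _|_] /=;
    [exact: mB|exact: measurableT].
  rewrite big_map big_enum/=; apply: eq_bigr => i _.
  by rewrite gaussianE WN /B'/= ?valK /= ?sqrtr1//; exact: mB.
congr (P _); apply/seteqP; split => w /=.
  move=> Bw _ /mapP[i _ ->]; rewrite /B'/= valK/=.
  by have := Bw i; rewrite tnth_mktuple.
move=> Bw i; rewrite tnth_mktuple.
have /= := Bw (b, val i); rewrite /B'/= valK/=; apply.
by apply/mapP; exists i; rewrite ?mem_enum.
Qed.

End noise.

(** * Gaussian integrals on the line *)

Section density.
Local Open Scope ereal_scope.
Context d (X : measurableType d) (R : realType).
Variables (mu nu : {measure set X -> \bar R}) (w : X -> R).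
Hypotheses (mw : measurable_fun setT w) (w0 : forall x, (0 <= w x)%R).
Hypothesis nuE : forall A, measurable A -> nu A = \int[mu]_(x in A) (w x)%:E.

Import HBNNSimple.

Let integral_density_nnsfun (g : {nnsfun X >-> R}) :
  \int[nu]_x (g x)%:E = \int[mu]_x ((g x)%:E * (w x)%:E).
Proof.
transitivity (\sum_(k \in range g) (k%:E * nu (g @^-1` [set k]))).
  under eq_integral do rewrite fimfunE -fsumEFin//.
  rewrite ge0_integral_fsum//; last 2 first.
  - by move=> y; exact/measurable_EFinP/measurable_funM.
  - by move=> y x _; rewrite nnfun_muleindic_ge0.
  apply: eq_fsbigr => r _; rewrite integralZl_indic_nnsfun// integral_indic//=.
  by rewrite setIT.
transitivity (\int[mu]_x (\sum_(k \in range g)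
    ((k * \1_(g @^-1` [set k]) x)%:E * (w x)%:E))); last first.
  apply: eq_integral => x _; rewrite [in RHS]fimfunE -fsumEFin//.
  by rewrite ge0_mule_fsuml// => k; rewrite nnfun_muleindic_ge0.
rewrite ge0_integral_fsum//; last 2 first.
- move=> y; apply: emeasurable_funM; apply/measurable_EFinP => //.
  exact: measurable_funM.
- move=> y x _; apply: mule_ge0; last by rewrite lee_fin.
  by rewrite EFinM nnfun_muleindic_ge0.
apply: eq_fsbigr => r _.
have [r0|r0] := ltP r 0%R.
  rewrite preimage_nnfun0// measure0 mule0 integral0_eq// => x _.
  by rewrite indicE in_set0 mulr0 mul0e.
rewrite nuE// [in LHS]integral_mkcond/= -ge0_integralZl//; last 2 first.
- apply: (iffLR (measurable_restrictT _ _)) => //.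
  by apply: measurable_funTS; exact/measurable_EFinP.
- by move=> x _; rewrite erestrict_ge0// => y _; rewrite lee_fin.
apply: eq_integral => x _; rewrite EFinM -muleA; congr (_ * _).
by rewrite patchE indicE; case: ifPn => _; rewrite ?mul1e ?mul0e.
Qed.

Lemma ge0_integral_density (f : X -> \bar R) :
  measurable_fun setT f -> (forall x, 0 <= f x) ->
  \int[nu]_x f x = \int[mu]_x (f x * (w x)%:E).
Proof.
move=> mf f0; pose g := nnsfun_approx measurableT mf.
have gf x : (g n x)%:E @[n --> \oo] --> f x.
  exact: cvg_nnsfun_approx.
have ndg x : {homo (fun n => (g n x)%:E) : a b / (a <= b)%N >-> a <= b}.
  by move=> a b ab; rewrite lee_fin; exact/lefP/nd_nnsfun_approx.
transitivity (limn (fun n => \int[nu]_x (g n x)%:E)).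
  rewrite -monotone_convergence//.
  - by apply: eq_integral => x _; apply/esym/cvg_lim.
  - by move=> n; exact/measurable_EFinP.
  - by move=> n x _; rewrite lee_fin.
under eq_fun do rewrite integral_density_nnsfun.
rewrite -monotone_convergence//.
- apply: eq_integral => x _; apply/cvg_lim => //.
  by apply: cvgeZr => //; exact: gf.
- by move=> n; apply: emeasurable_funM; exact/measurable_EFinP.
- by move=> n x _; rewrite mule_ge0// lee_fin.
- by move=> x _ a b ab; rewrite lee_pmul// ?lee_fin//; exact: ndg.
Qed.

End density.

Section lebesgue_affine.
Local Open Scope ereal_scope.
Context {R : realType}.
Local Notation mu := (@lebesgue_measure R).
Implicit Types f : measurableTypeR R -> \bar R.

Lemma ge0_integral_lebesgue_affine (m c : R) f : (0 < c)%R ->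
  measurable_fun setT f -> (forall x, 0 <= f x) ->
  \int[mu]_x f x = c%:E * \int[mu]_x f (m + c * x)%R.
Proof.
move=> c0 mf f0; pose phi : measurableTypeR R -> measurableTypeR R :=
  fun x => (m + c * x)%R.
have mphi : measurable_fun setT phi.
  by apply: measurable_funD => //; exact: measurable_funM.
pose k := NngNum (ltW c0).
pose nu : {measure set (measurableTypeR R) -> \bar R} := mscale k
  (measure_function_pushforward__canonical__measure_function_Measure mu mphi).
have muE A : measurable A -> mu A = nu A.
  apply: lebesgue_measure_unique => _ [[a b] _ <-].
  rewrite /nu/= /mscale/= /pushforward/=.
  rewrite (_ : phi @^-1` _ = [set` `](a - m) / c, (b - m) / c]%R]); last first.
    apply/seteqP; split => x; rewrite /phi /= !in_itv/= ltr_pdivrMr// ler_pdivlMr//;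
      by rewrite ltrBlDl lerBrDl (mulrC x).
  rewrite !lebesgue_measure_itv/= !lte_fin ltr_pM2r ?invr_gt0// ltrD2r.
  case: ifPn => _; last by rewrite mule0.
  by rewrite -!EFinB -EFinM; congr EFin; field; rewrite gt_eqF.
transitivity (\int[nu]_x f x).
  by apply: eq_measure_integral => A mA _; exact: muE.
rewrite /nu ge0_integral_mscale//= ge0_integral_pushforward//.
Qed.

Lemma ge0_integral_lebesgueN f : measurable_fun setT f -> (forall x, 0 <= f x) ->
  \int[mu]_x f (- x)%R = \int[mu]_x f x.
Proof.
move=> mf f0; rewrite -[LHS](@ge0_integral_pushforward _ _ _ _ _
  (-%R : measurableTypeR R -> measurableTypeR R) _ mu setT)//.
  by apply: eq_measure_integral => A mA _; exact: lebesgue_measureN.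
Qed.

End lebesgue_affine.

Section gaussian_density.
Context {R : realType}.
Local Notation mu := (@lebesgue_measure R).
Implicit Types (v x : R) (f : measurableTypeR R -> \bar R).

Definition gpdf v x : R := expR (- (ln (2 * pi * v) + x ^+ 2 / v) / 2).

Lemma gpdf_gt0 v x : 0 < gpdf v x. Proof. exact: expR_gt0. Qed.

Lemma gpdf_ge0 v x : 0 <= gpdf v x. Proof. exact: expR_ge0. Qed.

Lemma measurable_gpdf v : measurable_fun setT (gpdf v).
Proof.
apply: measurableT_comp => //; apply: measurable_funM => //.
apply: measurableT_comp => //; apply: measurable_funD => //.
by apply: measurable_funM => //; exact: measurable_funX.
Qed.

Lemma measurable_gpdfV v : measurable_fun setT (fun x => (gpdf v x)^-1).
Proof.
under eq_fun do rewrite -expRN.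
apply: measurableT_comp => //; apply: measurableT_comp => //.
apply: measurable_funM => //.
apply: measurableT_comp => //; apply: measurable_funD => //.
by apply: measurable_funM => //; exact: measurable_funX.
Qed.

Lemma normal_pdf_gpdf v x : 0 < v -> normal_pdf 0 (Num.sqrt v) x = gpdf v x.
Proof.
move=> v0; rewrite normal_pdfE; last by rewrite gt_eqF// sqrtr_gt0.
rewrite /normal_peak /normal_fun sqr_sqrtr ?ltW// subr0 /gpdf.
have pv : 0 < 2 * pi * v by rewrite !mulr_gt0// pi_gt0.
rewrite (_ : v * pi *+ 2 = 2 * pi * v); last by rewrite -mulr_natl; ring.
have -> : - (ln (2 * pi * v) + x ^+ 2 / v) / 2 =
    - (ln (2 * pi * v) / 2) + - x ^+ 2 / (v *+ 2).
  by field; rewrite gt_eqF.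
rewrite expRD; congr (_ * expR _).
rewrite expRN; congr (_^-1).
apply: (@pexpIrn _ 2) => //; rewrite ?nnegrE ?sqrtr_ge0 ?expR_ge0//.
rewrite sqr_sqrtr ?ltW// -expRM_natl.
by rewrite (_ : 2 * (_ / 2) = ln (2 * pi * v)) ?lnK ?posrE//; field.
Qed.

Lemma normal_prob_density v A : 0 < v -> measurable A ->
  gaussian v A = (\int[mu]_(x in A) (gpdf v x)%:E)%E.
Proof.
move=> v0 mA; rewrite gaussianE; apply: eq_integral => x _.
by rewrite normal_pdf_gpdf.
Qed.

Lemma ge0_integral_gaussian v f : 0 < v ->
  measurable_fun setT f -> (forall x, 0 <= f x)%E ->
  (\int[gaussian v]_x f x = \int[mu]_x (f x * (gpdf v x)%:E))%E.
Proof.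
move=> v0 mf f0; apply: ge0_integral_density => //.
- exact: measurable_gpdf.
- by move=> x; exact: gpdf_ge0.
- by move=> A mA; exact: normal_prob_density.
Qed.

Lemma integral_gpdf v : 0 < v -> (\int[mu]_x (gpdf v x)%:E = 1)%E.
Proof.
by move=> v0; rewrite -(normal_prob_density v0 measurableT) probability_setT.
Qed.

Lemma integral_gpdf_shift v m : 0 < v -> (\int[mu]_x (gpdf v (x - m))%:E = 1)%E.
Proof.
move=> v0; rewrite -(integral_gpdf v0).
rewrite [RHS](ge0_integral_lebesgue_affine (- m) ltr01); last 2 first.
- by apply/measurable_EFinP; exact: measurable_gpdf.
- by move=> x; rewrite lee_fin gpdf_ge0.
by rewrite mul1e; apply: eq_integral => x _; rewrite mul1r addrC.
Qed.

Lemma ge0_integral_gaussian_shift u v x f : 0 < u -> 0 < v ->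
  measurable_fun setT f -> (forall x, 0 <= f x)%E ->
  (\int[gaussian u]_z (f (x + z)%R * (gpdf v (x + z) / gpdf u z)%:E) =
   \int[gaussian v]_y f y)%E.
Proof.
move=> u0 v0 mf f0.
have mD : measurable_fun setT (fun z : measurableTypeR R => (x + z)%R : measurableTypeR R).
  exact: measurable_funD.
have mg (w : R) : measurable_fun setT (gpdf w) := measurable_gpdf w.
rewrite !ge0_integral_gaussian//; last 2 first.
- apply: emeasurable_funM; first exact: (measurableT_comp mf mD).
  apply/measurable_EFinP; apply: measurable_funM; first exact: (measurableT_comp (mg v) mD).
  exact: measurable_gpdfV.
- by move=> z; rewrite mule_ge0// lee_fin; apply: divr_ge0; exact: gpdf_ge0.
rewrite [RHS](ge0_integral_lebesgue_affine x ltr01); last 2 first.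
- by apply: emeasurable_funM => //; apply/measurable_EFinP; exact: mg.
- by move=> z; rewrite mule_ge0// lee_fin gpdf_ge0.
rewrite mul1e; apply: eq_integral => z _; rewrite mul1r -muleA -EFinM.
by rewrite divfK// gt_eqF// gpdf_gt0.
Qed.

Lemma ge0_integral_gaussianN v f : 0 < v ->
  measurable_fun setT f -> (forall x, 0 <= f x)%E ->
  (\int[gaussian v]_x f (- x)%R = \int[gaussian v]_x f x)%E.
Proof.
move=> v0 mf f0.
have mN : measurable_fun setT (fun z : measurableTypeR R => (- z)%R : measurableTypeR R).
by exact: oppr_measurable.
rewrite !ge0_integral_gaussian//; last exact: (measurableT_comp mf mN).
rewrite -[RHS]ge0_integral_lebesgueN.
- by apply: eq_integral => x _; rewrite /gpdf sqrrN.
- by apply: emeasurable_funM => //; apply/measurable_EFinP; exact: measurable_gpdf.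
- by move=> z; rewrite mule_ge0// lee_fin gpdf_ge0.
Qed.

End gaussian_density.

Section gaussian_combination.
Context {R : realType}.
Local Notation mu := (@lebesgue_measure R).
Local Notation RM := (measurableTypeR R).
Implicit Types (a v x h c : R) (f : RM -> \bar R).

Lemma gpdf_scale c v x : 0 < c -> 0 < v ->
  c * gpdf (c ^+ 2 * v) (c * x) = gpdf v x.
Proof.
move=> c0 v0; have pi0 := pi_gt0 R.
rewrite -{1}[c]lnK ?posrE// /gpdf -expRD; congr expR.
have -> : 2 * pi * (c ^+ 2 * v) = c ^+ 2 * (2 * pi * v) by ring.
rewrite lnM ?posrE ?exprn_gt0 ?mulr_gt0// lnXn// -mulr_natl.
by field; rewrite !gt_eqF.
Qed.

Lemma gpdf_mul a c h y b : 0 < a -> 0 < c -> let s := h ^+ 2 * a + c in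
  gpdf c (b - h * y) * gpdf a y =
  gpdf s b * gpdf (a * c / s) (y - h * a * b / s).
Proof.
move=> a0 c0 s.
have s0 : 0 < s by rewrite ltr_wpDl// mulr_ge0// ?sqr_ge0 ?ltW.
rewrite /gpdf -!expRD; congr expR.
have -> : ln (2 * pi * (a * c / s)) =
    ln (2 * pi * a) + ln (2 * pi * c) - ln (2 * pi * s).
  move: (@pi R) (pi_gt0 R) => p p0.
  rewrite -lnM ?posrE ?mulr_gt0// -ln_div ?posrE ?mulr_gt0//; congr ln.
  by field; rewrite !gt_eqF.
move: (ln _) (ln _) (ln _) => la lc ls; move: s0; rewrite /s => s0.
by field; rewrite !gt_eqF.
Qed.

Lemma ge0_integral_gaussian_affine m c v f : 0 < c -> 0 < v ->
  measurable_fun setT f -> (forall x, 0 <= f x)%E ->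
  (\int[gaussian v]_x f (m + c * x)%R =
   \int[mu]_b (f b * (gpdf (c ^+ 2 * v) (b - m))%:E))%E.
Proof.
move=> c0 v0 mf f0.
have mphi : measurable_fun setT (fun x : RM => (m + c * x)%R : RM).
  by apply: measurable_funD => //; exact: measurable_funM.
have mg (w : R) : measurable_fun setT (gpdf w) := measurable_gpdf w.
rewrite (ge0_integral_gaussian (f := fun x => f (m + c * x)%R) v0
  (measurableT_comp mf mphi) (fun x => f0 (m + c * x)%R)).
rewrite [RHS](ge0_integral_lebesgue_affine m c0); last 2 first.
- apply: emeasurable_funM => //; apply/measurable_EFinP.
  by apply: (measurableT_comp (mg _)); exact: measurable_funB.
- by move=> x; rewrite mule_ge0// lee_fin gpdf_ge0.
rewrite -ge0_integralZl//; last 3 first.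
- apply: emeasurable_funM; first exact: (measurableT_comp mf mphi).
  apply/measurable_EFinP; apply: (measurableT_comp (mg _)).
  by apply: measurable_funB.
- by move=> x _; rewrite mule_ge0// lee_fin gpdf_ge0.
- by rewrite lee_fin ltW.
apply: eq_integral => x _; rewrite addrAC subrr add0r muleCA -EFinM.
by rewrite gpdf_scale.
Qed.

Lemma ge0_integral_gaussian_add a c h f : 0 < a -> 0 < c ->
  measurable_fun setT f -> (forall x, 0 <= f x)%E ->
  (\int[gaussian a]_y \int[gaussian 1]_z f (h * y + c * z)%R =
   \int[gaussian (h ^+ 2 * a + c ^+ 2)]_x f x)%E.
Proof.
move=> a0 c0 mf f0; set s := h ^+ 2 * a + c ^+ 2.
have c20 : 0 < c ^+ 2 by rewrite exprn_gt0.
have s0 : 0 < s by rewrite ltr_wpDl// mulr_ge0// ?sqr_ge0 ?ltW.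
have mg (w : R) : measurable_fun setT (gpdf w) := measurable_gpdf w.
pose F (p : RM * RM) := (f p.2 * (gpdf (c ^+ 2) (p.2 - h * p.1))%:E)%E.
have mF : measurable_fun setT F.
  apply: emeasurable_funM; first exact: (measurableT_comp mf).
  apply/measurable_EFinP; apply: (measurableT_comp (mg _)).
  apply: measurable_funB => //; exact: measurable_funM.
have F0 p : (0 <= F p)%E by rewrite mule_ge0// lee_fin gpdf_ge0.
under eq_integral => y _.
  rewrite ge0_integral_gaussian_affine// mulr1.
  over.
rewrite [LHS]ge0_integral_gaussian//; last 2 first.
- exact: (measurable_fun_fubini_tonelli_F (m2 := mu) F).
- by move=> y; apply: integral_ge0 => b _; exact: (F0 (y, b)).
transitivity (\int[mu]_y \int[mu]_b (F (y, b) * (gpdf a y)%:E))%E.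
  apply: eq_integral => y _; rewrite ge0_integralZr//.
  - exact: (measurableT_comp mF (pair1_measurable y)).
  - by rewrite lee_fin gpdf_ge0.
rewrite (fubini_tonelli (fun p : RM * RM => F p * (gpdf a p.1)%:E)%E); last 2 first.
- apply: emeasurable_funM => //.
  by apply/measurable_EFinP; exact: (measurableT_comp (mg _)).
- by move=> p; rewrite mule_ge0// lee_fin gpdf_ge0.
rewrite ge0_integral_gaussian//; apply: eq_integral => b _ /=.
transitivity (\int[mu]_y ((f b * (gpdf s b)%:E) *
    (gpdf (a * c ^+ 2 / s) (y - h * a * b / s))%:E))%E.
  apply: eq_integral => y _.
  by rewrite /F/= -!muleA -!EFinM gpdf_mul.
rewrite ge0_integralZl//; last 3 first.
- apply/measurable_EFinP; apply: (measurableT_comp (mg _)).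
  exact: measurable_funB.
- by move=> y _; rewrite lee_fin gpdf_ge0.
- by rewrite mule_ge0// lee_fin gpdf_ge0.
by rewrite integral_gpdf_shift ?mule1// divr_gt0// mulr_gt0.
Qed.

(* For c = 0 the inner Gaussian variable drops out and h is a sign. *)
Lemma ge0_integral_gaussian_rotate a c h f : 0 < a -> 0 <= c ->
  h ^+ 2 + c ^+ 2 = 1 ->
  measurable_fun setT f -> (forall x, 0 <= f x)%E ->
  (\int[gaussian a]_y \int[gaussian 1]_z f (h * y + c * z)%R =
   \int[gaussian (h ^+ 2 * a + c ^+ 2)]_x f x)%E.
Proof.
move=> a0; rewrite le_eqVlt => /predU1P[<-|c0 _]; last exact: ge0_integral_gaussian_add.
rewrite expr0n/= !addr0 => h1 mf f0; rewrite h1 mul1r.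
transitivity (\int[gaussian a]_y f (h * y)%R)%E.
  apply: eq_integral => y _.
  under eq_integral do rewrite mul0r addr0.
  by rewrite integral_cst//= probability_setT mule1.
move/eqP: h1; rewrite sqrf_eq1 => /orP[] /eqP ->.
  by apply: eq_integral => y _; rewrite mul1r.
rewrite -[RHS]ge0_integral_gaussianN//.
by apply: eq_integral => y _; rewrite mulN1r.
Qed.

End gaussian_combination.

Section gaussian_moment.
Context {R : realType}.
Local Notation RM := (measurableTypeR R).
Local Notation gamma := (@gaussian R 1).

Lemma integral_gaussian_cst (r v : R) : (\int[gaussian v]_z r%:E = r%:E)%E.
Proof. by rewrite integral_cst//= probability_setT mule1. Qed.

Lemma gpdf_ratio (u v x y : R) : 0 < u -> 0 < v ->
  gpdf v y / gpdf u x =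
  expR ((ln u - ln v) / 2 + (x ^+ 2 / u - y ^+ 2 / v) / 2).
Proof.
move=> u0 v0; have pi0 := pi_gt0 R.
rewrite /gpdf -expRN -expRD; congr expR.
rewrite !(lnM (x := 2 * pi)) ?posrE ?mulr_gt0//.
by field; rewrite !gt_eqF.
Qed.

Lemma integral_gpdf_ratio (v : R) : 0 < v ->
  (\int[gamma]_z (gpdf v z / gpdf 1 z)%:E = 1)%E.
Proof.
move=> v0; rewrite -[RHS](integral_gaussian_cst 1 v).
rewrite -(ge0_integral_gaussian_shift 0 (f := cst 1%E) ltr01 v0)//.
by apply: eq_integral => z _; rewrite mul1e add0r.
Qed.

Let kappa : \bar R := (\int[gamma]_z (z ^+ 2)%:E)%E.

Let msq : measurable_fun setT (fun z : RM => z ^+ 2 : R).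
Proof. exact: measurable_funX. Qed.

Let kappaM (r : R) : 0 <= r -> (\int[gamma]_z (r * z ^+ 2)%:E = r%:E * kappa)%E.
Proof.
move=> r0; rewrite -ge0_integralZl//; last 2 first.
- exact/measurable_EFinP.
- by move=> x _; rewrite lee_fin sqr_ge0.
Qed.

(* Both bounds come from e^t >= 1 + t applied to the density ratio of N(0, v)
   and N(0, 1), whose integral is 1. *)
Let kappa_le (v : R) : 1 < v -> (kappa <= v%:E)%E.
Proof.
move=> v1; have v0 : 0 < v by apply: lt_trans v1.
pose r := (1 - v^-1) / 2.
have r0 : 0 < r by rewrite divr_gt0// subr_gt0 invf_lt1.
have lnv : 0 <= ln v / 2 by rewrite divr_ge0// ln_ge0// ltW.
have mr : measurable_fun setT (fun z : RM => gpdf v z / gpdf 1 z).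
  apply: measurable_funM; first exact: measurable_gpdf.
  exact: measurable_gpdfV.
have ratio0 z : 0 <= gpdf v z / gpdf (1 : R) z.
  by apply: divr_ge0; exact: gpdf_ge0.
have : (\int[gamma]_z (1%:E + (r * z ^+ 2)%:E) <=
        \int[gamma]_z ((gpdf v z / gpdf 1 z)%:E + (ln v / 2)%:E))%E.
  apply: ge0_le_integral => //.
  - by move=> z _; rewrite -EFinD lee_fin addr_ge0// mulr_ge0 ?sqr_ge0 ?ltW.
  - by apply: emeasurable_funD => //; apply/measurable_EFinP; exact: measurable_funM.
  - by apply: emeasurable_funD => //; apply/measurable_EFinP.
  move=> z _; rewrite -!EFinD lee_fin -lerBlDr gpdf_ratio// ln1.
  apply: le_trans (expR_ge1Dx _); rewrite /r le_eqVlt; apply/orP; left; apply/eqP.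
  by field; rewrite gt_eqF.
rewrite ge0_integralD//; last 2 first.
- by move=> z _; rewrite lee_fin mulr_ge0 ?sqr_ge0 ?ltW.
- by apply/measurable_EFinP; exact: measurable_funM.
rewrite [X in (_ <= X)%E -> _]ge0_integralD//; last 2 first.
- by move=> z _; rewrite lee_fin.
- exact/measurable_EFinP.
rewrite integral_gpdf_ratio// (integral_gaussian_cst 1).
rewrite (integral_gaussian_cst (ln v / 2)) (kappaM (ltW r0)).
rewrite leeD2lE// => h; rewrite -(@lee_pmul2l _ r%:E)//.
apply: (le_trans h); rewrite -EFinM lee_fin.
have : ln v <= v - 1.
  by rewrite -[X in ln X](subrK 1) addrC; apply: le_ln1Dx; lra.
have -> : r * v = (v - 1) / 2 by rewrite /r; field; rewrite gt_eqF.
lra.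
Qed.

Let kappa_ge (v : R) : 0 < v -> v < 1 -> (v%:E <= kappa)%E.
Proof.
move=> v0 v1; pose r := (v^-1 - 1) / 2.
have r0 : 0 < r by rewrite divr_gt0// subr_gt0 invf_gt1.
have lnv : ln v <= v - 1.
  by rewrite -[X in ln X](subrK 1) addrC; apply: le_ln1Dx; lra.
have lnv0 : 0 <= - ln v / 2 by lra.
have mr : measurable_fun setT (fun z : RM => gpdf v z / gpdf 1 z).
  apply: measurable_funM; first exact: measurable_gpdf.
  exact: measurable_gpdfV.
have ratio0 z : 0 <= gpdf v z / gpdf (1 : R) z.
  by apply: divr_ge0; exact: gpdf_ge0.
have : (\int[gamma]_z (1%:E + (- ln v / 2)%:E) <=
        \int[gamma]_z ((gpdf v z / gpdf 1 z)%:E + (r * z ^+ 2)%:E))%E.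
  apply: ge0_le_integral => //.
  - by move=> z _; rewrite -EFinD lee_fin addr_ge0.
  - by apply: emeasurable_funD; apply/measurable_EFinP => //; exact: measurable_funM.
  move=> z _; rewrite -!EFinD lee_fin -lerBlDr gpdf_ratio// ln1.
  apply: le_trans (expR_ge1Dx _); rewrite /r le_eqVlt; apply/orP; left; apply/eqP.
  by field; rewrite gt_eqF.
rewrite [X in (_ <= X)%E -> _]ge0_integralD//; last 4 first.
- by move=> z _; rewrite lee_fin.
- exact/measurable_EFinP.
- by move=> z _; rewrite lee_fin mulr_ge0 ?sqr_ge0 ?ltW.
- by apply/measurable_EFinP; exact: measurable_funM.
rewrite integral_gpdf_ratio// -EFinD (integral_gaussian_cst (1 + - ln v / 2)).
rewrite (kappaM (ltW r0)) EFinD leeD2lE// => h; rewrite -(@lee_pmul2l _ r%:E)//.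
apply: le_trans h; rewrite -EFinM lee_fin.
have -> : r * v = (1 - v) / 2 by rewrite /r; field; rewrite gt_eqF.
lra.
Qed.

Lemma integral_gaussian_sqr : (\int[gamma]_z (z ^+ 2)%:E = 1)%E.
Proof.
rewrite -/kappa; case: kappa kappa_le kappa_ge => [k|/(_ 2)|_ /(_ (2^-1))].
- move=> kle kge; congr EFin; apply/eqP; rewrite eq_le; apply/andP; split.
    apply/ler_addgt0Pr => e e0; rewrite -lee_fin; apply: kle.
    by rewrite ltrDl.
  apply/ler_addgt0Pr => e e0; rewrite -lerBlDr.
  have [e1|e1] := ltP e 1.
    by rewrite -lee_fin; apply: kge; rewrite ?subr_gt0// ltrBlDr ltrDl.
  rewrite (@le_trans _ _ 0)// ?subr_le0// -lee_fin.
  by rewrite (@le_trans _ _ (2^-1)%:E)// ?lee_fin ?invr_ge0//; apply: kge; lra.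
- by move=> h; have := h ltac:(lra); rewrite leye_eq.
- by move=> h; have := h ltac:(lra) ltac:(lra); rewrite leeNy_eq.
Qed.

Lemma integral_gaussian_shift_sqr (x : R) :
  (\int[gamma]_z ((x + z) ^+ 2)%:E = (x ^+ 2 + 1)%:E)%E.
Proof.
set I := (X in X = _).
have m1 : measurable_fun setT (fun z : RM => (x + z) ^+ 2).
  by apply: measurable_funX; exact: measurable_funD.
have m2 : measurable_fun setT (fun z : RM => (x - z) ^+ 2).
  by apply: measurable_funX; exact: measurable_funB.
have IE : (\int[gamma]_z ((x - z) ^+ 2)%:E = I)%E.
  apply: (ge0_integral_gaussianN (f := fun z => ((x + z) ^+ 2)%:E) ltr01).
  - exact/measurable_EFinP.
  - by move=> z; rewrite lee_fin sqr_ge0.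
have I0 : (0 <= I)%E by apply: integral_ge0 => z _; rewrite lee_fin sqr_ge0.
have : (I + I = (2 * x ^+ 2 + 2)%:E)%E.
  rewrite -{2}IE -ge0_integralD//; last 4 first.
  - by move=> z _; rewrite lee_fin sqr_ge0.
  - exact/measurable_EFinP.
  - by move=> z _; rewrite lee_fin sqr_ge0.
  - exact/measurable_EFinP.
  transitivity (\int[gamma]_z ((2 * x ^+ 2)%:E + (2 * z ^+ 2)%:E))%E.
    by apply: eq_integral => z _; rewrite -!EFinD; congr EFin; ring.
  rewrite ge0_integralD//; last 3 first.
  - by move=> z _; rewrite lee_fin mulr_ge0// sqr_ge0.
  - by move=> z _; rewrite lee_fin mulr_ge0// sqr_ge0.
  - by apply/measurable_EFinP; exact: measurable_funM.
  by rewrite (integral_gaussian_cst (2 * x ^+ 2)) kappaM// /kappa integral_gaussian_sqr mule1 EFinD.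
case: I I0 {IE} => // k _ [] kk; congr EFin; lra.
Qed.

End gaussian_moment.

(** * Change of measure for the degraded channel *)

Section change_of_measure.
Context {R : realType}.
Local Notation RM := (measurableTypeR R).
Local Open Scope ereal_scope.
Implicit Types (f : RM -> \bar R) (a x s h c : R).

Definition gaussian2 a : probability (RM * RM)%type R :=
  [the probability _ R of (gaussian a \x gaussian 1)%E].

Definition mix h c (p : RM * RM) : RM := (h * p.1 + c * p.2)%R.

Lemma measurable_mix h c : measurable_fun setT (mix h c).
Proof. by apply: measurable_funD; apply: measurable_funM. Qed.

Lemma ge0_integral_gaussian2_shift a x (f : RM * RM -> \bar R) : (0 < a)%R ->
  measurable_fun setT f -> (forall p, 0 <= f p) ->
  \int[gaussian2 1]_z (f ((x + z.1)%R, z.2) * (gpdf a (x + z.1) / gpdf 1 z.1)%:E) =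
  \int[gaussian2 a]_p f p.
Proof.
move=> a0 mf f0.
have mD : measurable_fun setT (fun z : RM => (x + z)%R : RM).
  exact: measurable_funD.
have mr : measurable_fun setT (fun z : RM => gpdf a (x + z) / gpdf 1 z)%R.
  apply: measurable_funM; last exact: measurable_gpdfV.
  exact: (measurableT_comp (measurable_gpdf a) mD).
have mF : measurable_fun setT (fun z : RM * RM =>
    f ((x + z.1)%R, z.2) * (gpdf a (x + z.1) / gpdf 1 z.1)%:E).
  apply: emeasurable_funM.
    apply: (measurableT_comp mf); apply/measurable_fun_pairP; split.
      by apply: (measurableT_comp mD); exact: measurable_fst.
    exact: measurable_snd.
  apply/measurable_EFinP; apply: (measurableT_comp mr); exact: measurable_fst.
rewrite [LHS](fubini_tonelli2 _ mF); last first.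
  by move=> z; rewrite mule_ge0// lee_fin; apply: divr_ge0; exact: gpdf_ge0.
rewrite [RHS](fubini_tonelli2 f mf f0); apply: eq_integral => z _.
apply: (ge0_integral_gaussian_shift x (f := fun y => f (y, z)) ltr01 a0) => //.
exact: (measurableT_comp mf (pair2_measurable z)).
Qed.

Lemma ge0_integral_gaussian2_mix a h c f : (0 < a)%R -> (0 <= c)%R ->
  (h ^+ 2 + c ^+ 2 = 1)%R ->
  measurable_fun setT f -> (forall y, 0 <= f y) ->
  \int[gaussian2 a]_p f (mix h c p) =
  \int[gaussian (h ^+ 2 * a + c ^+ 2)]_y f y.
Proof.
move=> a0 c0 hc mf f0.
rewrite [LHS](fubini_tonelli1 (fun p => f (mix h c p))) => [|//|].
- exact: ge0_integral_gaussian_rotate.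
- exact: (measurableT_comp mf (measurable_mix h c)).
- by move=> p.
Qed.

Lemma ge0_integral_gaussian2_mix_shift a h c s v f : (0 < a)%R -> (0 <= c)%R ->
  (h ^+ 2 + c ^+ 2 = 1)%R -> (0 < v)%R ->
  measurable_fun setT f -> (forall y, 0 <= f y) ->
  \int[gaussian2 a]_p (f (s + mix h c p)%R *
    (gpdf v (s + mix h c p) / gpdf (h ^+ 2 * a + c ^+ 2) (mix h c p))%:E) =
  \int[gaussian v]_y f y.
Proof.
move=> a0 c0 hc v0 mf f0.
set u := (h ^+ 2 * a + c ^+ 2)%R.
have u0 : (0 < u)%R.
  rewrite /u; have [h0|h0] := eqVneq h 0%R.
    by move: hc; rewrite h0 expr0n/= !add0r mul0r add0r => ->.
  by rewrite ltr_pwDl ?sqr_ge0// mulr_gt0// exprn_even_gt0.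
have mD : measurable_fun setT (fun z : RM => (s + z)%R : RM).
  exact: measurable_funD.
have mF : measurable_fun setT (fun b : RM => f (s + b)%R * (gpdf v (s + b) / gpdf u b)%:E).
  apply: emeasurable_funM; first exact: (measurableT_comp mf mD).
  apply/measurable_EFinP; apply: measurable_funM; last exact: measurable_gpdfV.
  exact: (measurableT_comp (measurable_gpdf v) mD).
rewrite (@ge0_integral_gaussian2_mix a h c
  (fun b => f (s + b)%R * (gpdf v (s + b) / gpdf u b)%:E))//.
  exact: ge0_integral_gaussian_shift.
by move=> b; rewrite mule_ge0// lee_fin; apply: divr_ge0; exact: gpdf_ge0.
Qed.

End change_of_measure.

Lemma integral_gaussian2_fst (R : realType) (f : measurableTypeR R -> \bar R) : measurable_fun setT f -> (forall y, 0 <= f y)%E ->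
  (\int[gaussian2 1]_z f z.1 = \int[gaussian 1]_y f y)%E.
Proof.
move=> mf f0.
have := @ge0_integral_gaussian2_mix _ 1 1 0 f ltr01 (lexx _).
rewrite expr1n expr0n/= mulr1 !addr0 => /(_ erefl mf f0) <-.
by apply: eq_integral => z _; rewrite /mix mul1r mul0r addr0.
Qed.

Section information_density.
Context {R : realType}.
Local Notation RM := (measurableTypeR R).
Variables (h c a v : R).
Hypotheses (hc : h ^+ 2 + c ^+ 2 = 1) (c0 : 0 <= c) (a1 : 1 <= a).
Let u := h ^+ 2 * a + c ^+ 2.
Hypothesis uv : u <= v.

Let a0 : 0 < a. Proof. exact: lt_le_trans a1. Qed.

Let u1 : 1 <= u.
Proof. by rewrite -hc lerD2r ler_peMr ?sqr_ge0. Qed.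

Let u0 : 0 < u. Proof. exact: lt_le_trans u1. Qed.

Let v0 : 0 < v. Proof. exact: lt_le_trans uv. Qed.

Definition rate : R := (ln a + ln v - ln (h ^+ 2 * a + c ^+ 2)) / 2.

Lemma rate_ge0 : 0 <= rate.
Proof.
rewrite divr_ge0// -addrA addr_ge0 ?ln_ge0// subr_ge0 ler_ln ?posrE//.
Qed.

Implicit Types (s x : R) (z : RM * RM).

Definition rxl s x z : R := s + mix h c (x + z.1, z.2).

Definition weightl s x z : R :=
  gpdf a (x + z.1) / gpdf 1 z.1 *
  (gpdf v (rxl s x z) / gpdf (h ^+ 2 * a + c ^+ 2) (mix h c (x + z.1, z.2))).

Definition upl s x z : R :=
  rate + ((2 * a)^-1 * (x + z.1) ^+ 2 + (2 * v)^-1 * rxl s x z ^+ 2).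

Definition lol x z : R :=
  2^-1 * (0 + z.1) ^+ 2 + (2 * (h ^+ 2 * a + c ^+ 2))^-1 * rxl 0 x z ^+ 2.

Lemma weightlE s x z : weightl s x z = expR (lol x z - upl s x z).
Proof.
have e1 := gpdf_ratio z.1 (x + z.1) ltr01 a0.
have e2 := gpdf_ratio (mix h c (x + z.1, z.2)) (rxl s x z) u0 v0.
transitivity (expR ((ln 1 - ln a) / 2 + (z.1 ^+ 2 / 1 - (x + z.1) ^+ 2 / a) / 2) *
  expR ((ln u - ln v) / 2 +
        (mix h c (x + z.1, z.2) ^+ 2 / u - rxl s x z ^+ 2 / v) / 2)).
  by rewrite -e1 -e2.
rewrite -expRD; congr expR.
rewrite /lol /upl /rate /rxl -/u ln1 !add0r; move: (ln _) (ln _) (ln _) => la lv lu.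
move: (mix _ _ _) u0 => b; move: u => w w0.
by field; rewrite !gt_eqF.
Qed.

Lemma rxlE s x z : rxl s x z = (s + h * x) + mix h c z.
Proof. by rewrite /rxl /mix/=; ring. Qed.

Let intmix (f : RM -> \bar R) : measurable_fun setT f -> (forall y, 0 <= f y)%E ->
  (\int[gaussian2 1]_z f (mix h c z) = \int[gaussian 1]_y f y)%E.
Proof.
move=> mf f0; rewrite (ge0_integral_gaussian2_mix ltr01 c0 hc mf f0).
by rewrite mulr1 hc.
Qed.

Let msq (r : R) : measurable_fun setT (fun y : RM => ((r + y) ^+ 2)%:E).
Proof. by apply/measurable_EFinP; apply: measurable_funX; exact: measurable_funD. Qed.

Let sq0 (r y : R) : (0 <= ((r + y) ^+ 2)%:E)%E.
Proof. by rewrite lee_fin sqr_ge0. Qed.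

Let mfst (r : R) : measurable_fun setT (fun z : RM * RM => (r + z.1) ^+ 2).
Proof.
apply: measurable_funX; apply: measurable_funD => //; exact: measurable_fst.
Qed.

Let mrx s x : measurable_fun setT (rxl s x).
Proof.
rewrite (_ : rxl s x = fun z => (s + h * x) + mix h c z).
  2: by apply/funext => z; exact: rxlE.
by apply: measurable_funD => //; exact: measurable_mix.
Qed.

Let sq_comb (k1 k2 r s x : R) : 0 <= k1 -> 0 <= k2 ->
  (\int[gaussian2 1]_z (k1 * (r + z.1) ^+ 2 + k2 * rxl s x z ^+ 2)%:E =
   (k1 * (r ^+ 2 + 1) + k2 * ((s + h * x) ^+ 2 + 1))%:E)%E.
Proof.
move=> k10 k20.
transitivity (\int[gaussian2 1]_z (k1%:E * ((r + z.1) ^+ 2)%:E +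
    k2%:E * ((rxl s x z) ^+ 2)%:E))%E; first exact: eq_integral.
rewrite ge0_integralD//; last 4 first.
- by move=> z _; rewrite mule_ge0.
- by apply: emeasurable_funM => //; apply/measurable_EFinP.
- by move=> z _; rewrite mule_ge0// lee_fin sqr_ge0.
- by apply: emeasurable_funM => //; apply/measurable_EFinP; exact: measurable_funX.
rewrite !ge0_integralZl//; last 3 first.
- by apply/measurable_EFinP; exact: measurable_funX.
- by move=> z _; rewrite lee_fin sqr_ge0.
- exact/measurable_EFinP.
have -> : (\int[gaussian2 1]_z ((r + z.1) ^+ 2)%:E = (r ^+ 2 + 1)%:E)%E.
  by rewrite (integral_gaussian2_fst (f := fun y => ((r + y) ^+ 2)%:E))// integral_gaussian_shift_sqr.
have -> : (\int[gaussian2 1]_z (rxl s x z ^+ 2)%:E = ((s + h * x) ^+ 2 + 1)%:E)%E.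
  under eq_integral do rewrite rxlE.
  rewrite (intmix (f := fun y => (((s + h * x) + y) ^+ 2)%:E))//.
  by rewrite integral_gaussian_shift_sqr.
by [].
Qed.

Lemma measurable_lol x : measurable_fun setT (lol x).
Proof.
apply: measurable_funD; apply: measurable_funM => //.
exact: measurable_funX.
Qed.

Lemma measurable_upl s x : measurable_fun setT (upl s x).
Proof.
apply: measurable_funD => //; apply: measurable_funD; apply: measurable_funM => //.
exact: measurable_funX.
Qed.

Lemma lol_ge0 x z : 0 <= lol x z.
Proof.
by rewrite addr_ge0// mulr_ge0 ?sqr_ge0 ?invr_ge0// mulr_ge0// ltW.
Qed.

Lemma upl_ge0 s x z : 0 <= upl s x z.
Proof.
rewrite addr_ge0 ?rate_ge0// addr_ge0// mulr_ge0 ?sqr_ge0 ?invr_ge0//;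
  by rewrite mulr_ge0// ltW.
Qed.

Lemma measurable_weightl s x : measurable_fun setT (weightl s x).
Proof.
rewrite (_ : weightl s x = fun z => expR (lol x z - upl s x z)).
  2: by apply/funext => z; exact: weightlE.
apply: measurableT_comp => //; apply: measurable_funB; first exact: measurable_lol.
exact: measurable_upl.
Qed.

Lemma integral_lol x : (\int[gaussian2 1]_z (lol x z)%:E =
  (2^-1 + (2 * (h ^+ 2 * a + c ^+ 2))^-1 * ((h * x) ^+ 2 + 1))%:E)%E.
Proof.
rewrite /lol sq_comb//; last by rewrite invr_ge0 mulr_ge0// ltW.
by rewrite expr0n/= !add0r mulr1.
Qed.

Lemma integral_upl s x : (\int[gaussian2 1]_z (upl s x z)%:E =
  (rate + ((2 * a)^-1 * (x ^+ 2 + 1) + (2 * v)^-1 * ((s + h * x) ^+ 2 + 1)))%:E)%E.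
Proof.
transitivity (\int[gaussian2 1]_z (rate%:E + ((2 * a)^-1 * (x + z.1) ^+ 2 +
    (2 * v)^-1 * rxl s x z ^+ 2)%:E))%E; first exact: eq_integral.
have pos w : 0 < w -> 0 <= (2 * w)^-1 :> R.
  by move=> w0; rewrite invr_ge0 mulr_ge0// ltW.
rewrite ge0_integralD//; last 3 first.
- by move=> z _; rewrite lee_fin rate_ge0.
- by move=> z _; rewrite lee_fin addr_ge0// mulr_ge0 ?sqr_ge0 ?pos.
- apply/measurable_EFinP; apply: measurable_funD; apply: measurable_funM => //.
  exact: measurable_funX.
rewrite sq_comb ?pos// integral_cst//=.
by rewrite [X in (_ * X)%E](@probability_setT _ _ _ (gaussian2 1)) mule1.
Qed.

End information_density.

Lemma sum_eq_natr (R : realType) (J : finType) (j : J) :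
  \sum_(i : J) (j == i)%:R = 1 :> R.
Proof.
by rewrite (bigD1 j)//= eqxx big1 ?addr0// => i ij; rewrite eq_sym (negbTE ij).
Qed.

Lemma measurable_fun_eq_natr d (Y : measurableType d) (R : realType) (J : finType)
    (g : Y -> J) (j : J) : measurable (g @^-1` [set j]) ->
  measurable_fun setT (fun y => (g y == j)%:R : R).
Proof.
move=> mg; rewrite (_ : (fun y => _) = \1_(g @^-1` [set j])).
  exact: measurable_indic.
apply/funext => y; rewrite indicE; congr (nat_of_bool _)%:R.
by apply/idP/idP => [/eqP gy|]; [rewrite inE|rewrite inE => /= ->].
Qed.

Section tuple_change_of_measure.
Context {R : realType} (n : nat).
Local Notation RM := (measurableTypeR R).
Local Notation Y := (n.-tuple RM).
Local Notation Z := (n.-tuple (RM * RM)%type).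
Variables (h c a v : R).
Hypotheses (hc : h ^+ 2 + c ^+ 2 = 1) (c0 : 0 <= c) (a1 : 1 <= a).
Hypothesis uv : h ^+ 2 * a + c ^+ 2 <= v.
Implicit Types (s x : 'I_n -> R) (t : Z).

Let u := h ^+ 2 * a + c ^+ 2.

Let a0 : 0 < a. Proof. exact: lt_le_trans a1. Qed.

Let v0 : 0 < v.
Proof.
apply: lt_le_trans uv; rewrite (lt_le_trans ltr01)// -[leLHS]hc lerD2r.
by rewrite ler_peMr ?sqr_ge0.
Qed.

Definition rx1 s x t : Y := [tuple rxl h c (s i) (x i) (tnth t i) | i < n].

Definition rx2 x t : Y := [tuple (x i + (tnth t i).1 : RM) | i < n].

Definition weight s x t : R := \prod_(i < n) weightl h c a v (s i) (x i) (tnth t i).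

Definition noise2 : probability Z R := tprod (fun=> gaussian2 1).

Lemma measurable_rx1 s x : measurable_fun setT (rx1 s x).
Proof.
apply: (measurable_tuple_map (phi := fun i => rxl h c (s i) (x i))) => i.
rewrite (_ : rxl h c (s i) (x i) = fun z => (s i + h * x i) + mix h c z).
  2: by apply/funext => z; exact: rxlE.
by apply: measurable_funD => //; exact: measurable_mix.
Qed.

Lemma measurable_rx2 x : measurable_fun setT (rx2 x).
Proof.
apply: (measurable_tuple_map (phi := fun i (z : RM * RM) => (x i + z.1 : RM))) => i.
by apply: measurable_funD => //; exact: measurable_fst.
Qed.

Lemma measurable_weight s x : measurable_fun setT (weight s x).
Proof.
apply: (measurable_prod_tnth (w := fun i => weightl h c a v (s i) (x i))) => i.
exact: measurable_weightl.
Qed.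

Lemma weight_ge0 s x t : 0 <= weight s x t.
Proof. by apply: prodr_ge0 => i _; rewrite weightlE// expR_ge0. Qed.

Lemma sum_integral_weight (J K : finType) (s : J -> 'I_n -> R) (x : K -> 'I_n -> R)
    (d1 : Y -> J) (d2 : J -> Y -> K) :
  (forall j, measurable (d1 @^-1` [set j])) ->
  (forall j k, measurable (d2 j @^-1` [set k])) ->
  (\sum_(j : J) \sum_(k : K) \int[noise2]_t
     ((d1 (rx1 (s j) (x k) t) == j)%:R * (d2 j (rx2 (x k) t) == k)%:R
       * weight (s j) (x k) t)%:E = 1)%E.
Proof.
move=> md1 md2.
pose y1 s (p : Z) : Y := [tuple (s i + mix h c (tnth p i) : RM) | i < n].
pose y2 (p : Z) : Y := [tuple (tnth p i).1 | i < n].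
pose ratio (s : R) (p : RM * RM) : R :=
  gpdf v (s + mix h c p) / gpdf u (mix h c p).
pose G s (p : Z) : R := \prod_(i < n) ratio (s i) (tnth p i).
have ratio0 r p : 0 <= ratio r p by apply: divr_ge0; exact: gpdf_ge0.
have mshift (r : R) : measurable_fun setT (fun p => r + mix h c p : RM).
  by apply: measurable_funD => //; exact: measurable_mix.
have mratio r : measurable_fun setT (ratio r).
  apply: measurable_funM.
    exact: (measurableT_comp (measurable_gpdf v) (mshift r)).
  exact: (measurableT_comp (measurable_gpdfV u) (measurable_mix h c)).
have mG r : measurable_fun setT (G r).
  by apply: (measurable_prod_tnth (w := fun i => ratio (r i))) => i.
have G0 r p : 0 <= G r p by apply: prodr_ge0 => i _.
have my1 r : measurable_fun setT (y1 r).
  by apply: (measurable_tuple_map (phi := fun i p => r i + mix h c p : RM)) => i.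
have my2 : measurable_fun setT y2.
  apply: (measurable_tuple_map (phi := fun i (p : RM * RM) => p.1)) => i.
  exact: measurable_fst.
have mb1 j r : measurable_fun setT (fun p => (d1 (y1 r p) == j)%:R : R).
  exact: (measurableT_comp (measurable_fun_eq_natr (md1 j)) (my1 r)).
have mb2 j k : measurable_fun setT (fun p => (d2 j (y2 p) == k)%:R : R).
  exact: (measurableT_comp (measurable_fun_eq_natr (md2 j k)) my2).
pose F j k (p : Z) : R :=
  (d1 (y1 (s j) p) == j)%:R * (d2 j (y2 p) == k)%:R * G (s j) p.
have mF j k : measurable_fun setT (F j k).
  by apply: measurable_funM => //; exact: measurable_funM.
have F0 j k p : 0 <= F j k p by rewrite mulr_ge0.
have step1 j k : (\int[noise2]_t
     ((d1 (rx1 (s j) (x k) t) == j)%:R * (d2 j (rx2 (x k) t) == k)%:R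
       * weight (s j) (x k) t)%:E =
   \int[tprod (fun=> gaussian2 a)]_p (F j k p)%:E)%E.
  rewrite -(@ge0_integral_tprod_image _ _ _ _ _ n (fun=> gaussian2 1)
    (fun=> gaussian2 a) (fun i z => (x k i + z.1, z.2) : RM * RM)
    (fun i z => gpdf a (x k i + z.1) / gpdf 1 z.1)).
  - apply: eq_integral => t _; rewrite -EFinM; congr EFin.
    set p := [tuple _ | i < n].
    have e1 : y1 (s j) p = rx1 (s j) (x k) t.
      by apply: eq_from_tnth => i; rewrite !tnth_mktuple.
    have e2 : y2 p = rx2 (x k) t.
      by apply: eq_from_tnth => i; rewrite !tnth_mktuple.
    rewrite /F e1 e2 -[RHS]mulrA; congr (_ * _).
    rewrite /G -big_split; apply: eq_bigr => i _ /=.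
    by rewrite tnth_mktuple /weightl mulrC.
  - move=> i; apply/measurable_fun_pairP; split; last exact: measurable_snd.
    by apply: measurable_funD => //; exact: measurable_fst.
  - move=> i; apply: measurable_funM.
      apply: (measurableT_comp (measurable_gpdf a)).
      by apply: measurable_funD => //; exact: measurable_fst.
    by apply: (measurableT_comp (measurable_gpdfV 1)); exact: measurable_fst.
  - by move=> i z; apply: divr_ge0; exact: gpdf_ge0.
  - by move=> i f mf f0; exact: ge0_integral_gaussian2_shift.
  - exact/measurable_EFinP.
  - by move=> p; rewrite lee_fin.
have step2 j : (\sum_(k : K) \int[tprod (fun=> gaussian2 a)]_p (F j k p)%:E =
    \int[tprod (fun=> gaussian2 a)]_p ((d1 (y1 (s j) p) == j)%:R%:E * (G (s j) p)%:E))%E.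
  rewrite -ge0_integral_sum//; last 2 first.
  - by move=> k; exact/measurable_EFinP.
  - by move=> k p _; rewrite lee_fin.
  apply: eq_integral => p _; rewrite sumEFin -EFinM; congr EFin.
  by rewrite -mulr_suml -mulr_sumr sum_eq_natr mulr1.
have step3 j : (\int[tprod (fun=> gaussian2 a)]_p
      ((d1 (y1 (s j) p) == j)%:R%:E * (G (s j) p)%:E) =
    \int[tprod (fun=> gaussian v)]_y ((d1 y == j)%:R)%:E)%E.
  apply: (@ge0_integral_tprod_image _ _ _ _ _ n (fun=> gaussian2 a)
    (fun=> gaussian v) (fun i p => s j i + mix h c p : RM)
    (fun i => ratio (s j i)) _ _ _ _ (fun y => ((d1 y == j)%:R)%:E)) => //.
  - by move=> i f mf f0; exact: ge0_integral_gaussian2_mix_shift.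
  - by apply/measurable_EFinP; exact: measurable_fun_eq_natr.
under eq_bigr => j _.
  under eq_bigr do rewrite step1.
  rewrite step2 step3.
  over.
rewrite -ge0_integral_sum//; last first.
- by move=> j; apply/measurable_EFinP; exact: measurable_fun_eq_natr.
under eq_integral do rewrite sumEFin sum_eq_natr.
by rewrite integral_cst//= probability_setT mule1.
Qed.

End tuple_change_of_measure.

Section gaussian_converse.
Context {R : realType} (n : nat).
Local Notation RM := (measurableTypeR R).
Local Notation Y := (n.-tuple RM).
Local Notation Z := (n.-tuple (RM * RM)%type).
Variables (h c a v : R).
Hypotheses (hc : h ^+ 2 + c ^+ 2 = 1) (c0 : 0 <= c) (a1 : 1 <= a).
Hypothesis uv : h ^+ 2 * a + c ^+ 2 <= v.
Implicit Types (s x : 'I_n -> R) (t : Z).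

Local Notation upl := (upl h c a v).
Local Notation lol := (lol h c a).
Local Notation weight := (weight h c a v).
Local Notation rate := (rate h c a v).
Local Notation rx1 := (rx1 h c).
Local Notation noise2 := (@noise2 R n).

Let up s x t := \sum_(i < n) upl (s i) (x i) (tnth t i).
Let lo x t := \sum_(i < n) lol (x i) (tnth t i).

Let weightE s x t : weight s x t = expR (lo x t - up s x t).
Proof.
rewrite /up /lo -sumrB expR_sum; apply: eq_bigr => i _.
exact: weightlE.
Qed.

Let lo_ge0 x t : 0 <= lo x t.
Proof. by apply: sumr_ge0 => i _; exact: lol_ge0. Qed.

Let up_ge0 s x t : 0 <= up s x t.
Proof. by apply: sumr_ge0 => i _; exact: upl_ge0. Qed.

Let mlo x : measurable_fun setT (lo x).
Proof.
apply: measurable_sum => i.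
by apply: (measurableT_comp (measurable_lol h c a (x i))); exact: measurable_tnth.
Qed.

Let mup s x : measurable_fun setT (up s x).
Proof.
apply: measurable_sum => i.
apply: (measurableT_comp (measurable_upl h c a v (s i) (x i))).
exact: measurable_tnth.
Qed.

Let intlo x : (\int[noise2]_t (lo x t)%:E =
  (\sum_(i < n) (2^-1 + (2 * (h ^+ 2 * a + c ^+ 2))^-1 * ((h * x i) ^+ 2 + 1)))%:E)%E.
Proof.
rewrite (ge0_integral_tprod_sum (fun=> gaussian2 1)
  (g := fun i => lol (x i))); last 2 first.
- by move=> i; exact: measurable_lol.
- by move=> i z; exact: lol_ge0.
by rewrite -sumEFin; apply: eq_bigr => i _; exact: integral_lol.
Qed.

Let intup s x : (\int[noise2]_t (up s x t)%:E =
  (\sum_(i < n) (rate + ((2 * a)^-1 * (x i ^+ 2 + 1) +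
     (2 * v)^-1 * ((s i + h * x i) ^+ 2 + 1))))%:E)%E.
Proof.
rewrite (ge0_integral_tprod_sum (fun=> gaussian2 1)
  (g := fun i => upl (s i) (x i))); last 2 first.
- by move=> i; exact: measurable_upl.
- by move=> i z; exact: upl_ge0.
by rewrite -sumEFin; apply: eq_bigr => i _; exact: integral_upl.
Qed.

Let intweight s x : (\int[noise2]_t (weight s x t)%:E = 1)%E.
Proof.
have := @sum_integral_weight R n h c a v hc c0 a1 uv unit unit
  (fun=> s) (fun=> x) (fun=> tt) (fun _ _ => tt).
have mT (b : unit) : measurable ((fun=> tt) @^-1` [set b] : set Y).
  by case: b; rewrite (_ : _ @^-1` _ = setT)//; apply/seteqP; split.
move=> /(_ mT (fun=> mT)) <-; rewrite (bigD1 tt)//= (bigD1 tt)//=.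
rewrite !big1; last 2 first.
- by case.
- by case.
by rewrite !adde0; apply: eq_integral => t _; rewrite ?eqxx !mul1r.
Qed.

(* e^t >= 1 + t with t = L 1_ok - up + lo, integrated. *)
Let success_bound s x (ok : Z -> bool) (L : R) : 0 <= L ->
  measurable_fun setT (fun t => (ok t)%:R : R) ->
  (L%:E * \int[noise2]_t ((ok t)%:R)%:E + \int[noise2]_t (lo x t)%:E <=
   (expR L)%:E * \int[noise2]_t ((ok t)%:R * weight s x t)%:E +
   \int[noise2]_t (up s x t)%:E)%E.
Proof.
move=> L0 mok.
have mw : measurable_fun setT (weight s x) by exact: measurable_weight.
have w0 t : 0 <= weight s x t by exact: weight_ge0.
have mokw : measurable_fun setT (fun t => (ok t)%:R * weight s x t).
  exact: measurable_funM.
have E1 t : 1 + (L * (ok t)%:R + lo x t) <=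
    weight s x t + (expR L * ((ok t)%:R * weight s x t) + up s x t).
  have := w0 t; rewrite weightE => w0t.
  case: (ok t); rewrite ?mulr1 ?mulr0 ?mul1r ?mul0r ?mulr0.
    have := expR_ge1Dx (L + (lo x t - up s x t)).
    by rewrite expRD; move: (expR L * _) => q; lra.
  by have := expR_ge1Dx (lo x t - up s x t); lra.
rewrite -(@leeD2lE _ 1)//.
have -> : (1 + (L%:E * \int[noise2]_t ((ok t)%:R)%:E + \int[noise2]_t (lo x t)%:E) =
    \int[noise2]_t (1%:E + (L%:E * ((ok t)%:R)%:E + (lo x t)%:E)))%E.
  rewrite ge0_integralD//; last 2 first.
  - by move=> t _; rewrite -EFinM -EFinD lee_fin addr_ge0// mulr_ge0.
  - apply: emeasurable_funD; last exact/measurable_EFinP.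
    by apply: emeasurable_funM => //; exact/measurable_EFinP.
  rewrite integral_cst//= probability_setT mule1; congr (_ + _)%E.
  rewrite ge0_integralD//; last 4 first.
  - by move=> t _; rewrite -EFinM lee_fin mulr_ge0.
  - by apply: emeasurable_funM => //; exact/measurable_EFinP.
  - by move=> t _; rewrite lee_fin.
  - exact/measurable_EFinP.
  rewrite ge0_integralZl//; first exact/measurable_EFinP.
have -> : (1 + ((expR L)%:E * \int[noise2]_t ((ok t)%:R * weight s x t)%:E +
      \int[noise2]_t (up s x t)%:E) =
    \int[noise2]_t ((weight s x t)%:E + ((expR L)%:E *
      ((ok t)%:R * weight s x t)%:E + (up s x t)%:E)))%E.
  rewrite ge0_integralD//; last 4 first.
  - by move=> t _; rewrite lee_fin.
  - exact/measurable_EFinP.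
  - move=> t _; rewrite -EFinM -EFinD lee_fin addr_ge0// mulr_ge0 ?expR_ge0//.
    by rewrite mulr_ge0.
  - apply: emeasurable_funD; last exact/measurable_EFinP.
    by apply: emeasurable_funM => //; exact/measurable_EFinP.
  rewrite intweight; congr (_ + _)%E.
  rewrite ge0_integralD//; last 4 first.
  - by move=> t _; rewrite -EFinM lee_fin mulr_ge0 ?expR_ge0// mulr_ge0.
  - by apply: emeasurable_funM => //; exact/measurable_EFinP.
  - by move=> t _; rewrite lee_fin.
  - exact/measurable_EFinP.
  rewrite ge0_integralZl//; last 2 first.
  - exact/measurable_EFinP.
  - by move=> t _; rewrite lee_fin mulr_ge0.
apply: ge0_le_integral => //.
- by move=> t _; rewrite -EFinM -!EFinD lee_fin !addr_ge0// mulr_ge0.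
- apply: emeasurable_funD => //; apply: emeasurable_funD; last exact/measurable_EFinP.
  by apply: emeasurable_funM => //; exact/measurable_EFinP.
- apply: emeasurable_funD; first exact/measurable_EFinP.
  apply: emeasurable_funD; last exact/measurable_EFinP.
  by apply: emeasurable_funM => //; exact/measurable_EFinP.
- by move=> t _; rewrite -!EFinM -!EFinD lee_fin.
Qed.

Definition decoded (J K : finType) (s : J -> 'I_n -> R) (x : K -> 'I_n -> R)
    (d1 : Y -> J) (d2 : J -> Y -> K) (j : J) (k : K) : set Z :=
  [set t | (d1 (rx1 (s j) (x k) t) == j) && (d2 j (rx2 (x k) t) == k)].

Lemma measurable_decoded (J K : finType) (s : J -> 'I_n -> R) (x : K -> 'I_n -> R)
    (d1 : Y -> J) (d2 : J -> Y -> K) j k :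
  measurable (d1 @^-1` [set j]) -> measurable (d2 j @^-1` [set k]) ->
  measurable (decoded s x d1 d2 j k).
Proof.
move=> md1 md2.
have -> : decoded s x d1 d2 j k = (rx1 (s j) (x k) @^-1` (d1 @^-1` [set j])) `&`
    (rx2 (x k) @^-1` (d2 j @^-1` [set k])).
  apply/seteqP; split => t; rewrite /decoded/=.
    by move=> /andP[/eqP ? /eqP ?]; split.
  by move=> [-> ->]; rewrite !eqxx.
apply: measurableI; rewrite -[X in measurable X]setTI.
  exact: measurable_rx1.
exact: measurable_rx2.
Qed.

Lemma gaussian_converse (J K : finType) (s : J -> 'I_n -> R) (x : K -> 'I_n -> R)
    (d1 : Y -> J) (d2 : J -> Y -> K) (L : R) :
  (forall j, measurable (d1 @^-1` [set j])) ->
  (forall j k, measurable (d2 j @^-1` [set k])) -> 0 <= L ->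
  L * \sum_(j : J) \sum_(k : K) fine (noise2 (decoded s x d1 d2 j k)) <=
  expR L + \sum_(j : J) \sum_(k : K) \sum_(i < n)
    (rate + ((2 * a)^-1 * (x k i ^+ 2 + 1) +
             (2 * v)^-1 * ((s j i + h * x k i) ^+ 2 + 1)) -
     (2^-1 + (2 * (h ^+ 2 * a + c ^+ 2))^-1 * ((h * x k i) ^+ 2 + 1))).
Proof.
move=> md1 md2 L0.
pose ok j k t := (d1 (rx1 (s j) (x k) t) == j) && (d2 j (rx2 (x k) t) == k).
have okE j k t : (ok j k t)%:R = (d1 (rx1 (s j) (x k) t) == j)%:R *
    (d2 j (rx2 (x k) t) == k)%:R :> R by rewrite -mulnb natrM.
have mok j k : measurable_fun setT (fun t => (ok j k t)%:R : R).
  under eq_fun do rewrite okE.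
  apply: measurable_funM.
    exact: (measurableT_comp (measurable_fun_eq_natr (md1 j)) (measurable_rx1 _ _ _ _)).
  exact: (measurableT_comp (measurable_fun_eq_natr (md2 j k)) (measurable_rx2 _)).
have mdec j k : measurable (decoded s x d1 d2 j k) by exact: measurable_decoded.
have intok j k : (\int[noise2]_t ((ok j k t)%:R)%:E =
    noise2 (decoded s x d1 d2 j k))%E.
  rewrite -[decoded s x d1 d2 j k]setIT -integral_indic//; apply: eq_integral => t _.
  rewrite indicE; congr ((nat_of_bool _)%:R%:E).
  by apply/idP/idP => [|]; rewrite inE.
pose q j k : \bar R := (\int[noise2]_t ((ok j k t)%:R * weight (s j) (x k) t)%:E)%E.
have q0 j k : (0 <= q j k)%E.
  apply: integral_ge0 => t _; rewrite lee_fin mulr_ge0//.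
  exact: weight_ge0.
have sumq : (\sum_j \sum_k q j k = 1)%E.
  rewrite -(sum_integral_weight hc c0 a1 uv s x md1 md2).
  apply: eq_bigr => j _; apply: eq_bigr => k _; apply: eq_integral => t _.
  by rewrite okE.
have qfin j k : q j k \is a fin_num.
  rewrite ge0_fin_numE// (@le_lt_trans _ _ 1%E) ?ltry//.
  rewrite -sumq; apply: (@le_trans _ _ (\sum_k' q j k')%E).
    by rewrite [leRHS](bigD1 k)//= leeDl// sume_ge0.
  by rewrite [leRHS](bigD1 j)//= leeDl// sume_ge0// => i _; rewrite sume_ge0.
have sumfq : \sum_j \sum_k fine (q j k) = 1.
  apply: EFin_inj; rewrite -sumq -sumEFin; apply: eq_bigr => j _.
  by rewrite -sumEFin; apply: eq_bigr => k _; rewrite fineK.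
have -> : expR L = \sum_j \sum_k expR L * fine (q j k).
  rewrite -[LHS]mulr1 -[X in _ * X = _]sumfq mulr_sumr; apply: eq_bigr => j _.
  by rewrite mulr_sumr.
rewrite mulr_sumr -big_split/=; apply: ler_sum => j _.
rewrite mulr_sumr -big_split/=; apply: ler_sum => k _.
have nfin : noise2 (decoded s x d1 d2 j k) \is a fin_num.
  exact: fin_num_measure.
have := success_bound (s j) (x k) L0 (mok j k).
rewrite intok intlo intup -/(q j k).
case: (q j k) (qfin j k) => // qr _; case: (noise2 _) nfin => // nr _ /=.
by rewrite -!EFinM -!EFinD lee_fin sumrB addrA lerBrDr.
Qed.

End gaussian_converse.

(** * Power constraint *)

Section power_budget.
Context {R : realType}.

Lemma sumr_constT (K : finType) (r : R) : \sum_(k : K) r = #|K|%:R * r.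
Proof. by rewrite mulr_natl -sumr_const; apply: eq_bigl. Qed.

Lemma sum_sqr_centered (K : finType) (y : K -> R) :
  \sum_k (y k - (\sum_l y l) / #|K|%:R) ^+ 2 <= \sum_k y k ^+ 2.
Proof.
set m := _ / _; have [K0|K0] := eqVneq (#|K|%:R : R) 0.
  apply: ler_sum => k _; suff : m = 0 by move=> ->; rewrite subr0.
  by rewrite /m K0 invr0 mulr0.
have -> : \sum_k (y k - m) ^+ 2 =
    \sum_k y k ^+ 2 - 2 * m * (\sum_k y k) + #|K|%:R * m ^+ 2.
  rewrite mulr_sumr -sumrB -sumr_constT -big_split/=.
  by apply: eq_bigr => k _; ring.
have -> : \sum_k y k = m * #|K|%:R.
  by rewrite /m divfK.
have : 0 <= #|K|%:R * m ^+ 2 by rewrite mulr_ge0 ?ler0n ?sqr_ge0.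
by move: (\sum_k y k ^+ 2) => q; nra.
Qed.

Lemma sum_centered (K : finType) (y : K -> R) : (0 < #|K|)%N ->
  \sum_k (y k - (\sum_l y l) / #|K|%:R) = 0.
Proof.
move=> K0; rewrite sumrB sumr_constT mulrC divfK ?subrr//.
by rewrite pnatr_eq0 -lt0n.
Qed.

Lemma sum_sqr_add (J K : finType) (y : J -> R) (z : K -> R) :
  \sum_k z k = 0 ->
  \sum_j \sum_k (y j + z k) ^+ 2 =
  #|K|%:R * (\sum_j y j ^+ 2) + #|J|%:R * (\sum_k z k ^+ 2).
Proof.
move=> z0.
have E j : \sum_k (y j + z k) ^+ 2 =
    #|K|%:R * y j ^+ 2 + \sum_k z k ^+ 2.
  transitivity (\sum_k (y j ^+ 2 + (2 * y j * z k + z k ^+ 2))).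
    by apply: eq_bigr => k _; ring.
  by rewrite !big_split/= -[X in _ + (X + _)]mulr_sumr z0 mulr0 add0r sumr_constT.
under eq_bigr do rewrite E.
by rewrite big_split/= -mulr_sumr sumr_constT.
Qed.

Lemma power_budget n (J K : finType) (s : J -> 'I_n -> R) (x : K -> 'I_n -> R)
    (h Q P3 a u v r : R) : a = 1 + P3 -> u = 1 + h ^+ 2 * P3 -> v = u + Q ->
  h ^+ 2 <= 1 -> 0 <= Q -> 0 <= P3 ->
  (forall i, \sum_k x k i = 0) ->
  \sum_j \sum_i s j i ^+ 2 <= #|J|%:R * (n%:R * Q) ->
  \sum_k \sum_i x k i ^+ 2 <= #|K|%:R * (n%:R * P3) ->
  \sum_j \sum_k \sum_(i < n)
    (r + ((2 * a)^-1 * (x k i ^+ 2 + 1) +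
          (2 * v)^-1 * ((s j i + h * x k i) ^+ 2 + 1)) -
     (2^-1 + (2 * u)^-1 * ((h * x k i) ^+ 2 + 1))) <=
  #|J|%:R * #|K|%:R * (n%:R * r).
Proof.
move=> aE uE vE h1 Q0 P30 x0 sQ xP.
have a0 : 0 < a by rewrite aE ltr_pwDl.
have hP : 0 <= h ^+ 2 * P3 by rewrite mulr_ge0 ?sqr_ge0.
have u0 : 0 < u by rewrite uE ltr_pwDl.
have v0 : 0 < v by rewrite vE ltr_wpDr.
pose A := (2 * a)^-1 - (2 * u)^-1 * h ^+ 2.
pose B := (2 * v)^-1.
have [C CE] : exists C, C = r + (2 * a)^-1 + B - 2^-1 - (2 * u)^-1 by eexists.
have B0 : 0 <= B by rewrite invr_ge0 mulr_ge0// ltW.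
have A0 : 0 <= A.
  have -> : A = (u - a * h ^+ 2) / (2 * a * u).
    by rewrite /A; field; rewrite !gt_eqF.
  rewrite divr_ge0 ?mulr_ge0 ?(ltW a0) ?(ltW u0)// aE uE subr_ge0.
  by rewrite mulrDl mul1r mulrC lerD2r.
pose X i := \sum_k x k i ^+ 2; pose S i := \sum_j s j i ^+ 2.
have Ei i : \sum_j \sum_k
    (r + ((2 * a)^-1 * (x k i ^+ 2 + 1) +
          (2 * v)^-1 * ((s j i + h * x k i) ^+ 2 + 1)) -
     (2^-1 + (2 * u)^-1 * ((h * x k i) ^+ 2 + 1))) =
    #|J|%:R * #|K|%:R * C + (A + B * h ^+ 2) * #|J|%:R * X i + B * #|K|%:R * S i.
  transitivity (\sum_j \sum_k (C + A * x k i ^+ 2 + B * (s j i + h * x k i) ^+ 2)).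
    by apply: eq_bigr => j _; apply: eq_bigr => k _; rewrite /A CE /B; ring.
  transitivity (\sum_(j : J) (#|K|%:R * C + A * X i) +
      B * \sum_j \sum_k (s j i + h * x k i) ^+ 2).
    rewrite [B * _]mulr_sumr -big_split/=; apply: eq_bigr => j _.
    by rewrite !big_split/= sumr_constT; congr (_ + _ + _); rewrite ?/X mulr_sumr.
  rewrite (sum_sqr_add (s^~ i) (z := fun k => h * x k i)); last first.
    by rewrite -mulr_sumr x0 mulr0.
  rewrite sumr_constT.
  have -> : \sum_k (h * x k i) ^+ 2 = h ^+ 2 * X i.
    by rewrite mulr_sumr; apply: eq_bigr => k _; rewrite exprMn.
  by rewrite /S; ring.
under eq_bigr do rewrite exchange_big/=.
rewrite exchange_big/=; under eq_bigr do rewrite Ei.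
rewrite !big_split/= sumr_constT card_ord -!mulr_sumr.
have SX : \sum_i X i <= #|K|%:R * (n%:R * P3) by rewrite exchange_big.
have SS : \sum_i S i <= #|J|%:R * (n%:R * Q) by rewrite exchange_big.
have rE : r = C + (A + B * h ^+ 2) * P3 + B * Q.
  transitivity (C + (2 * a)^-1 * P3 - (2 * u)^-1 * (h ^+ 2 * P3)
      + B * (h ^+ 2 * P3 + Q)); last by rewrite /A; ring.
  have -> : P3 = a - 1 by rewrite aE; ring.
  have -> : h ^+ 2 * (a - 1) = u - 1 by rewrite uE aE; ring.
  have -> : u - 1 + Q = v - 1 by rewrite vE; ring.
  by rewrite CE /B; field; rewrite !gt_eqF.
have AB0 : 0 <= (A + B * h ^+ 2) * #|J|%:R.
  by rewrite mulr_ge0// addr_ge0// mulr_ge0// sqr_ge0.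
have BK0 : 0 <= B * #|K|%:R by rewrite mulr_ge0.
apply: le_trans (lerD (lerD (lexx _) (ler_wpM2l AB0 SX)) (ler_wpM2l BK0 SS)) _.
by rewrite rE le_eqVlt; apply/orP; left; apply/eqP; ring.
Qed.

End power_budget.

Lemma tprod_preimage (R : realType) d d' (X : measurableType d)
    (Y : measurableType d') n
    (mu : 'I_n -> probability X R) (nu : 'I_n -> probability Y R)
    (phi : 'I_n -> X -> Y) (A : set (n.-tuple Y)) :
  (forall j, measurable_fun setT (phi j)) ->
  (forall j (f : Y -> \bar R), measurable_fun setT f -> (forall y, 0 <= f y)%E ->
     (\int[mu j]_x f (phi j x) = \int[nu j]_y f y)%E) ->
  measurable A ->
  tprod mu [set t | A [tuple phi j (tnth t j) | j < n]] = tprod nu A.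
Proof.
move=> mphi munu mA; pose g (t : n.-tuple X) := [tuple phi j (tnth t j) | j < n].
have mg : measurable_fun setT g by exact: measurable_tuple_map.
have mgA : measurable (g @^-1` A).
  by rewrite -[X in measurable X]setTI; exact: mg.
rewrite -[A in RHS]setIT -integral_indic//.
rewrite -(@ge0_integral_tprod_image _ _ _ _ _ n mu nu phi (fun _ _ => 1))//.
- rewrite -[LHS](_ : tprod mu (g @^-1` A `&` setT) = _); last by rewrite setIT.
  rewrite -integral_indic//; apply: eq_integral => t _.
  by rewrite big1// mule1 !indicE.
- move=> j f mf f0; rewrite -munu//.
  by apply: eq_integral => x _; rewrite mule1.
- by apply/measurable_EFinP; exact: measurable_indic.
Qed.

(** * From codes to rates *)

Section code_bound.
Context {R : realType} {d} {T : measurableType d}.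
Local Notation RM := (measurableTypeR R).
Variables (P : probability T R) (W : bool -> nat -> T -> R).
Hypothesis iidW : iid_std_gaussian_noise P W.
Variables (h12 h22 h : R) (n M1 M2 M3 : nat) (cd : @pimac_code R n M1 M2 M3).
Hypothesis mcd : decoders_measurable cd.

Local Notation Y := (n.-tuple RM).
Local Notation noise2 := (@noise2 R n).
Local Notation err m1 m2 m3 := (error_event W h12 h22 h cd m1 m2 m3).

Let V b (w : T) : Y := [tuple W b j w | j < n].

Let mV b : measurable_fun setT (V b).
Proof.
apply/measurable_fun_tnthP => i; rewrite (_ : _ \o _ = W b i).
  by case: iidW => mW _; exact: mW.
by apply/funext => w /=; rewrite tnth_mktuple.
Qed.

Let shift (r : 'I_n -> R) (y : Y) : Y := [tuple (r i + tnth y i : RM) | i < n].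

Let mshift r : measurable_fun setT (shift r).
Proof.
apply: (measurable_tuple_map (phi := fun i y => r i + y : RM)) => i.
exact: measurable_funD.
Qed.

Let A1 m1 m2 m3 : set Y := shift (fun i => enc1 cd m1 i + enc2 cd m2 i + h * enc3 cd m3 i)
  @^-1` ~` (dec1 cd @^-1` [set (m1, m2)]).

Let A2 m1 m2 m3 : set Y := shift (fun i => h12 * enc1 cd m1 i + h22 * enc2 cd m2 i + enc3 cd m3 i)
  @^-1` ~` (dec2 cd @^-1` [set m3]).

Let mA1 m1 m2 m3 : measurable (A1 m1 m2 m3).
Proof.
rewrite -[X in measurable X]setTI; apply: mshift => //.
by apply: measurableC; case: mcd => m _; exact: m.
Qed.

Let mA2 m1 m2 m3 : measurable (A2 m1 m2 m3).
Proof.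
rewrite -[X in measurable X]setTI; apply: mshift => //.
by apply: measurableC; case: mcd => _ m; exact: m.
Qed.

Let errE m1 m2 m3 : err m1 m2 m3 =
  (V false @^-1` A1 m1 m2 m3) `|` (V true @^-1` A2 m1 m2 m3).
Proof.
have sE r b w : shift r (V b w) = [tuple r i + W b i w | i < n].
  by apply: eq_from_tnth => i; rewrite !tnth_mktuple.
by apply/seteqP; split => w; rewrite /A1 /A2 /error_event /= !sE.
Qed.

Let mVA b A : measurable A -> measurable (V b @^-1` A).
Proof. by move=> mA; rewrite -[X in measurable X]setTI; exact: mV. Qed.

Let merr m1 m2 m3 : measurable (err m1 m2 m3).
Proof. by rewrite errE; apply: measurableU; exact: mVA. Qed.

Let perr m1 m2 m3 := fine (P (err m1 m2 m3)).

Lemma avg_errorE : avg_error P W h12 h22 h cd =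
  ((\sum_(m1 < M1) \sum_(m2 < M2) \sum_(m3 < M3) perr m1 m2 m3) /
    (M1 * M2 * M3)%:R)%:E.
Proof.
rewrite /avg_error EFinM; congr (_ * _)%E; rewrite -sumEFin.
apply: eq_bigr => m1 _; rewrite -sumEFin; apply: eq_bigr => m2 _.
by rewrite -sumEFin; apply: eq_bigr => m3 _; rewrite fineK ?fin_num_measure.
Qed.

Variables (P1 P2 P3 : R).
Hypotheses (P10 : 0 <= P1) (P20 : 0 <= P2) (P30 : 0 <= P3) (h1 : h ^+ 2 <= 1).
Hypotheses (M10 : (0 < M1)%N) (M20 : (0 < M2)%N) (M30 : (0 < M3)%N).
Hypotheses (pw1 : power_ok (enc1 cd) P1) (pw2 : power_ok (enc2 cd) P2)
  (pw3 : power_ok (enc3 cd) P3).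

(* Z_1 is realised as h Z_2 + c Z'. *)
Let c := Num.sqrt (1 - h ^+ 2).

Let c0 : 0 <= c. Proof. exact: sqrtr_ge0. Qed.

Let hc : h ^+ 2 + c ^+ 2 = 1.
Proof. by rewrite sqr_sqrtr ?subr_ge0// addrCA subrr addr0. Qed.

Let PV1 (A : set Y) : measurable A ->
  P (V false @^-1` A) =
  noise2 [set t : n.-tuple (RM * RM)%type | A [tuple (mix h c (tnth t i) : RM) | i < n]].
Proof.
move=> mA; rewrite (noise_law iidW)//; apply/esym.
apply: (tprod_preimage (mu := fun=> gaussian2 1) (phi := fun=> mix h c)) => //.
- by move=> j; exact: measurable_mix.
- move=> j f mf f0; rewrite (ge0_integral_gaussian2_mix ltr01 c0 hc)//.
  by rewrite mulr1 hc.
Qed.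

Let PV2 (A : set Y) : measurable A ->
  P (V true @^-1` A) =
  noise2 [set t : n.-tuple (RM * RM)%type | A [tuple (tnth t i).1 | i < n]].
Proof.
move=> mA; rewrite (noise_law iidW)//; apply/esym.
apply: (tprod_preimage (mu := fun=> gaussian2 1) (phi := fun _ (z : RM * RM) => z.1)) => //.
- by move=> j; exact: measurable_fst.
- by move=> j f mf f0; exact: integral_gaussian2_fst.
Qed.

Let mean M (f : 'I_M -> 'I_n -> R) i := (\sum_(m < M) f m i) / M%:R.

Let cen M (f : 'I_M -> 'I_n -> R) m i := f m i - mean f i.

Let cen_sum M (f : 'I_M -> 'I_n -> R) i : (0 < M)%N -> \sum_(m < M) cen f m i = 0.
Proof.
move=> M0; have := @sum_centered R 'I_M (fun m => f m i).
by rewrite card_ord => /(_ M0).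
Qed.

Let cen_power M (f : 'I_M -> 'I_n -> R) Pw : (0 < M)%N -> power_ok f Pw ->
  \sum_(m < M) \sum_(i < n) cen f m i ^+ 2 <= M%:R * (n%:R * Pw).
Proof.
move=> M0; rewrite /power_ok ler_pdivrMr ?ltr0n// [_ * M%:R]mulrC; apply: le_trans.
rewrite exchange_big [leRHS]exchange_big/=; apply: ler_sum => i _.
by have := @sum_sqr_centered R 'I_M (fun m => f m i); rewrite card_ord.
Qed.

Let x1 := cen (enc1 cd).
Let x2 := cen (enc2 cd).
Let x3 := cen (enc3 cd).

Let s (j : 'I_M1 * 'I_M2) i := x1 j.1 i + x2 j.2 i.

Let s_power : \sum_j \sum_i s j i ^+ 2 <=
  #|{: 'I_M1 * 'I_M2}|%:R * (n%:R * (P1 + P2)).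
Proof.
rewrite card_prod !card_ord natrM exchange_big/=.
under eq_bigr => i _.
  rewrite -(pair_bigA _ (fun m1 m2 => (x1 m1 i + x2 m2 i) ^+ 2))/=.
  rewrite sum_sqr_add ?card_ord; last exact: cen_sum.
  over.
rewrite big_split/= -!mulr_sumr.
have h1' := cen_power M10 pw1; have h2' := cen_power M20 pw2.
rewrite exchange_big/= in h1'; rewrite exchange_big/= in h2'.
apply: le_trans (lerD (ler_wpM2l _ h1') (ler_wpM2l _ h2')) _ => //.
by rewrite le_eqVlt; apply/orP; left; apply/eqP; ring.
Qed.

Let d1 : Y -> 'I_M1 * 'I_M2 := dec1 cd \o
  shift (fun i => mean (enc1 cd) i + mean (enc2 cd) i + h * mean (enc3 cd) i).

Let d2 (j : 'I_M1 * 'I_M2) : Y -> 'I_M3 := dec2 cd \o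
  shift (fun i => h12 * enc1 cd j.1 i + h22 * enc2 cd j.2 i + mean (enc3 cd) i).

Let md1 j : measurable (d1 @^-1` [set j]).
Proof.
rewrite /d1 comp_preimage -[X in measurable X]setTI; apply: mshift => //.
by case: mcd => m _; exact: m.
Qed.

Let md2 j k : measurable (d2 j @^-1` [set k]).
Proof.
rewrite /d2 comp_preimage -[X in measurable X]setTI; apply: mshift => //.
by case: mcd => _ m; exact: m.
Qed.

Let dec := decoded h c s x3 d1 d2.

Let decE m1 m2 m3 : ~` dec (m1, m2) m3 `<=`
  [set t | A1 m1 m2 m3 [tuple (mix h c (tnth t i) : RM) | i < n]] `|`
  [set t | A2 m1 m2 m3 [tuple (tnth t i).1 | i < n]].
Proof.
move=> t /negP; rewrite negb_and => /orP[/eqP e|/eqP e]; [left|right] => /=.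
  rewrite /A1/= => e1; apply: e; rewrite -[RHS]e1 /d1/=; congr (dec1 cd _).
  apply: eq_from_tnth => i; rewrite !tnth_mktuple rxlE /s /x1 /x2 /x3 /cen /=.
  by ring.
rewrite /A2/= => e1; apply: e; rewrite -[RHS]e1 /d2/=; congr (dec2 cd _).
apply: eq_from_tnth => i; rewrite !tnth_mktuple /x3 /cen /=.
by ring.
Qed.

Let dec_ge m1 m2 m3 : 1 - 2 * perr m1 m2 m3 <= fine (noise2 (dec (m1, m2) m3)).
Proof.
have mdec : measurable (dec (m1, m2) m3) by exact: measurable_decoded.
set B1 := [set t | A1 m1 m2 m3 [tuple (mix h c (tnth t i) : RM) | i < n]] : set (n.-tuple (RM * RM)%type).
set B2 := [set t | A2 m1 m2 m3 [tuple (tnth t i).1 | i < n]] : set (n.-tuple (RM * RM)%type).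
have mB1 : measurable B1.
  have mm : measurable_fun setT (fun t : n.-tuple (RM * RM)%type =>
      [tuple (mix h c (tnth t i) : RM) | i < n]).
    by apply: (measurable_tuple_map (phi := fun=> mix h c)) => i; exact: measurable_mix.
  by rewrite -[X in measurable X]setTI; exact: mm.
have mB2 : measurable B2.
  have mm : measurable_fun setT (fun t : n.-tuple (RM * RM)%type =>
      [tuple ((tnth t i).1 : RM) | i < n]).
    by apply: (measurable_tuple_map (phi := fun _ (z : RM * RM) => z.1)) => i; exact: measurable_fst.
  by rewrite -[X in measurable X]setTI; exact: mm.
have perrE : P (err m1 m2 m3) = (perr m1 m2 m3)%:E by rewrite fineK ?fin_num_measure.
have B1le : (noise2 B1 <= (perr m1 m2 m3)%:E)%E.
  rewrite -perrE -PV1// errE; apply: le_measure; rewrite ?inE; [exact: mVA| |exact: subsetUl].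
  by apply: measurableU; exact: mVA.
have B2le : (noise2 B2 <= (perr m1 m2 m3)%:E)%E.
  rewrite -perrE -PV2// errE; apply: le_measure; rewrite ?inE; [exact: mVA| |exact: subsetUr].
  by apply: measurableU; exact: mVA.
have : (noise2 (~` dec (m1, m2) m3) <= (2 * perr m1 m2 m3)%:E)%E.
  apply: (@le_trans _ _ (noise2 (B1 `|` B2))).
    apply: le_measure; rewrite ?inE; [exact: measurableC|exact: measurableU|exact: decE].
  apply: le_trans (measureU2 _ _ _) _ => //.
  by rewrite mulr2n mulrDl mul1r EFinD; exact: leeD.
rewrite probability_setC//.
have : noise2 (dec (m1, m2) m3) \is a fin_num by exact: fin_num_measure.
by case: (noise2 _) => // r _; rewrite -EFinB lee_fin /=; lra.
Qed.

Lemma pimac_code_bound :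
  (1 - 2 * fine (avg_error P W h12 h22 h cd)) * ln (M1 * M2 * M3)%:R <=
  1 + n%:R * ((ln (1 + P3) + ln (1 + h ^+ 2 * P3 + (P1 + P2)) - ln (1 + h ^+ 2 * P3)) / 2).
Proof.
set N := (M1 * M2 * M3)%:R; set r := (_ / 2).
have N0 : 0 < N by rewrite ltr0n !muln_gt0 M10 M20.
have NE : N = #|{: 'I_M1 * 'I_M2}|%:R * #|'I_M3|%:R :> R.
  by rewrite card_prod !card_ord -natrM.
pose a := 1 + P3; pose u := 1 + h ^+ 2 * P3; pose v := u + (P1 + P2).
have uE : h ^+ 2 * a + c ^+ 2 = u.
  by rewrite /a mulrDr mulr1 addrAC hc.
have a1 : 1 <= a by rewrite lerDl.
have uv : h ^+ 2 * a + c ^+ 2 <= v by rewrite uE lerDl addr_ge0.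
have L0 : 0 <= ln N.
  by rewrite ln_ge0// ler1n !muln_gt0 M10 M20.
have := @gaussian_converse R n h c a v hc c0 a1 uv _ _ s x3 d1 d2 (ln N) md1 md2 L0.
rewrite lnK ?posrE// uE.
have -> : rate h c a v = r by rewrite /rate uE.
have x30 i : \sum_k x3 k i = 0 by exact: cen_sum.
have x3p : \sum_k \sum_i x3 k i ^+ 2 <= #|'I_M3|%:R * (n%:R * P3).
  by rewrite card_ord; exact: cen_power.
move=> /le_trans.
move/(_ _ (lerD (lexx N) (power_budget r (erefl a) (erefl u) (erefl v) h1 (addr_ge0 P10 P20) P30
  x30 s_power x3p))).
rewrite -NE => main.
rewrite avg_errorE/=; set E := \sum_(m1 < M1) _.
have : N - 2 * E <= \sum_j \sum_k fine (noise2 (dec j k)).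
  have -> : N - 2 * E = \sum_(m1 < M1) \sum_(m2 < M2) \sum_(m3 < M3)
      (1 - 2 * perr m1 m2 m3).
    under [RHS]eq_bigr => m1 _.
      under eq_bigr => m2 _.
        rewrite sumrB sumr_constT card_ord mulr1 -mulr_sumr.
        over.
      rewrite sumrB sumr_constT card_ord -mulr_sumr.
      over.
    by rewrite sumrB sumr_constT card_ord -mulr_sumr mulrA -!natrM.
  rewrite pair_bigA/=; apply: ler_sum => -[m1 m2] _; apply: ler_sum => m3 _.
  exact: dec_ge.
move=> /(ler_wpM2l L0) /le_trans/(_ main) fin.
rewrite -(ler_pM2l N0).
have key (y e l : R) : y != 0 -> y * ((1 - 2 * (e / y)) * l) = l * (y - 2 * e).
  by move=> y0; field.
rewrite key ?gt_eqF//.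
by rewrite [leRHS]mulrDr mulr1.
Qed.

End code_bound.

Section message_count.
Context {R : realType} (n : nat) (r : R).

Let pow_gt0 : 0 < (2 : R) `^ (n%:R * r). Proof. by rewrite powR_gt0. Qed.

Let nmsgE : (nmsg n r)%:R = (Num.ceil ((2 : R) `^ (n%:R * r)))%:~R :> R.
Proof.
by rewrite /nmsg natr_absz ger0_norm// ceil_ge0 (lt_trans _ pow_gt0) ?ltrN10.
Qed.

Lemma nmsg_ge : (2 : R) `^ (n%:R * r) <= (nmsg n r)%:R.
Proof. by rewrite nmsgE ceil_ge. Qed.

Lemma nmsg_gt0 : (0 < nmsg n r)%N.
Proof. by rewrite -(ltr0n R); exact: lt_le_trans nmsg_ge. Qed.

Lemma ln_nmsg_ge : n%:R * r * ln 2 <= ln (nmsg n r)%:R.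
Proof.
by rewrite -ln_powR ler_ln ?posrE ?ltr0n ?nmsg_gt0//; exact: nmsg_ge.
Qed.

End message_count.

Lemma power_ok_ge0 (R : realType) M (f : 'I_M -> 'I_1 -> R) (Pw : R) :
  power_ok f Pw -> 0 <= Pw.
Proof.
rewrite /power_ok mul1r; apply: le_trans; rewrite divr_ge0//.
by apply: sumr_ge0 => m _; apply: sumr_ge0 => i _; rewrite sqr_ge0.
Qed.

Theorem theorem1 (R : realType) (d : measure_display) (T : measurableType d)
  (P : probability T R) (W : bool -> nat -> T -> R)
  (h12 h22 h31 P1 P2 P3 : R) :
  iid_std_gaussian_noise P W ->
  h31 ^+ 2 <= 1 ->
  forall R1 R2 R3 : R,
    pimac_achievable P W h12 h22 h31 P1 P2 P3 R1 R2 R3 ->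
    R1 + R2 + R3 <= log2 (1 + (P1 + P2) / (1 + h31 ^+ 2 * P3)) / 2
                    + log2 (1 + P3) / 2.
Proof.
move=> iidW h1 R1 R2 R3 [cd [pw [mcd err0]]].
have [/power_ok_ge0 P10 [/power_ok_ge0 P20 /power_ok_ge0 P30]] := pw 1%N.
have u0 : 0 < 1 + h31 ^+ 2 * P3 by rewrite ltr_pwDl// mulr_ge0// sqr_ge0.
have v0 : 0 < 1 + h31 ^+ 2 * P3 + (P1 + P2) by rewrite ltr_pwDl// addr_ge0.
pose K := (ln (1 + P3) + ln (1 + h31 ^+ 2 * P3 + (P1 + P2)) -
  ln (1 + h31 ^+ 2 * P3)) / 2.
have ln20 : 0 < ln (2 : R) by rewrite ln_gt0// ltr1n.
have -> : log2 (1 + (P1 + P2) / (1 + h31 ^+ 2 * P3)) / 2 + log2 (1 + P3) / 2 =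
    K / ln 2.
  have -> : 1 + (P1 + P2) / (1 + h31 ^+ 2 * P3) =
      (1 + h31 ^+ 2 * P3 + (P1 + P2)) / (1 + h31 ^+ 2 * P3).
    by rewrite [RHS]mulrDl divff ?gt_eqF.
  by rewrite /log2 ln_div ?posrE// /K; field; rewrite gt_eqF.
rewrite ler_pdivlMr// leNgt; apply/negP; set r := _ * ln 2 => Kr.
have K0 : 0 <= K.
  rewrite divr_ge0// -addrA addr_ge0 ?ln_ge0 ?lerDl// subr_ge0.
  by rewrite ler_ln ?posrE// lerDl addr_ge0.
have r0 : 0 < r by exact: le_lt_trans Kr.
pose e n := fine (avg_error P W h12 h22 h31 (cd n)).
have bound n : (1 - 2 * e n) * ln (nmsg n R1 * nmsg n R2 * nmsg n R3)%:R <=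
    1 + n%:R * K.
  have [pw1 [pw2 pw3]] := pw n.
  by apply: (pimac_code_bound iidW) => //; exact: nmsg_gt0.
have rate n : n%:R * r <= ln (nmsg n R1 * nmsg n R2 * nmsg n R3)%:R.
  rewrite !natrM !lnM ?posrE ?mulr_gt0 ?ltr0n ?nmsg_gt0//.
  rewrite /r (_ : n%:R * _ = n%:R * R1 * ln 2 + n%:R * R2 * ln 2 +
    n%:R * R3 * ln 2); last by ring.
  by rewrite !lerD// ln_nmsg_ge.
pose eta := (r - K) / (4 * r).
have eta0 : 0 < eta by rewrite divr_gt0 ?subr_gt0// mulr_gt0.
have etar : 4 * eta * r = r - K by rewrite /eta; field; rewrite gt_eqF.
have /cvgrPdist_lt/(_ _ eta0)[N _ eN] : e n @[n --> \oo] --> 0.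
  exact: (fine_cvg err0).
pose n := (N + Num.bound (2 / (r - K)))%N.
have /= := eN n (leq_addr _ _); rewrite sub0r normrN => /(le_lt_trans (ler_norm _)) en.
have nb : 2 / (r - K) < n%:R.
  rewrite natrD ltr_wpDl// archi_boundP// divr_ge0// subr_ge0 ltW//.
rewrite ltr_pdivrMr ?subr_gt0// in nb.
have eta4 : 4 * eta <= 1.
  by rewrite -(ler_pM2r r0) etar mul1r lerBlDr lerDl.
have e0 : 0 <= 1 - 2 * e n by lra.
have := le_trans (ler_wpM2l e0 (rate n)) (bound n).
have n0 : (0 : R) <= n%:R by [].
suff : n%:R * ((r + K) / 2) <= (1 - 2 * e n) * (n%:R * r).
  by move=> h2 h3; have := le_trans h2 h3; lra.
have -> : (r + K) / 2 = (1 - 2 * eta) * r by lra.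
rewrite mulrCA; apply: ler_wpM2r; first by rewrite mulr_ge0// ltW.
by lra.
Qed.
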